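(* Let $X$ be a hyperelliptic Riemann surface of genus $g$ with branch set $B(X)=\{p_1,\dots,p_{2g+2}\}$, and let $D$ denote the divisor class of $2p_i$, $p_i\in B(X)$. Assume $m=2n$ and $n\mid g-1$. Then every $m$-spin divisor supported on the branch set is (up to linear equivalence) of the form $$\theta= kD+p_{i_{1}}+\cdots + p_{i_{\frac{g-1-2nk}{n}}},$$ where $k$ is an integer with $\frac{g(n-1)+n+1}{-2n}\le k \le \frac{g-1}{2n}$ and the indices $i_1,i_2,\dots$ are pairwise distinct. This representation is unique when $\frac{g(n-1)+n+1}{-2n}< k \le \frac{g-1}{2n}$, and when $k=\frac{g(n-1)+n+1}{-2n}$ it is subject to the relation $$\tfrac{g(n-1)+n+1}{-2n}D+p_{i_1} +\cdots+p_{i_{g+1}} = \tfrac{g(n-1)+n+1}{-2n}D+p_{j_1} +\cdots+p_{j_{g+1}},$$ where $\{j_1,\dots,j_{g+1}\}$ is the complement of $\{i_1,\dots,i_{g+1}\}$ in $\{1,\dots,2g+2\}$.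
   Context: A hyperelliptic surface $X$ of genus $g$ is the compact Riemann surface defined by $y^2=\prod_{i=1}^{N}(x-e_i)$ with distinct $e_i\in\mathbb{C}$ and $N=2g+2$ or $N=2g+1$; the map $\pi:(x,y)\mapsto x$ is a double covering of the Riemann sphere with $2g+2$ ramification points $p_1,\dots,p_{2g+2}$ (lying over the $e_i$, and also over $\infty$ when $N=2g+1$). The branch set is $B(X)=\{p_1,\dots,p_{2g+2}\}$ (branch points are identified with ramification points). One has $2p_i\sim 2p_j$ for all $i,j$, so the class $D$ is independent of $i$. Divisors are considered up to linear equivalence, and equality of divisors means linear equivalence. An $m$-spin divisor (for $m\ge2$, $m\mid 2g-2$) is a divisor class $\theta$ with $m\theta=K_X$, the canonical class; it is supported on the branch set if it can be represented by an integer combination of the points of $B(X)$. *)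

(* Defs.v *)
From HB Require Import structures.
From mathcomp Require Import all_boot all_order all_algebra.
From mathcomp Require Import complex freeg.
From mathcomp Require Import all_classical all_reals all_analysis.

Set Implicit Arguments.
Unset Strict Implicit.
Unset Printing Implicit Defensive.

Import Order.TTheory GRing.Theory Num.Theory numFieldNormedType.Exports.
Local Open Scope classical_set_scope.
Local Open Scope ring_scope.
Local Open Scope complex_scope.

(* The usual topology on R[i], as the normed space over itself; with it,
   [derivable u z 1] is complex differentiability of [u : R[i] -> R[i]]. *)
HB.instance Definition _ (R : rcfType) := NormedModule.copy R[i] (R[i]^o).

(* The compact Riemann surface of y^2 = \prod_i (x - e i), N = 2g+1 or 2g+2,
   is obtained by gluing two smooth affine curves
        y^2 = \prod_i (x - e i)     and
        v^2 = w^(2g+2-N) \prod_i (1 - w e i)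
   along w = 1/x, v = y/x^(g+1).  Its points are those of the first curve,
   together with the points w = 0 of the second one, which lie over infinity:
   v = 1 and v = -1 if N = 2g+2, and only v = 0 if N = 2g+1. *)
Section Surface.
Context (R : realType) (g N : nat) (e : 'I_N -> R[i]).

Definition affine_rhs (x : R[i]) : R[i] := \prod_(i < N) (x - e i).

Definition infinity_rhs (w : R[i]) : R[i] :=
  w ^+ (2 * g + 2 - N) * \prod_(i < N) (1 - w * e i).

Definition affine_point : choiceType :=
  {q : R[i] * R[i] | q.2 ^+ 2 == affine_rhs q.1}.

Definition infinite_point : choiceType :=
  {v : R[i] | v ^+ 2 == infinity_rhs 0}.

Definition hyperelliptic : choiceType := (affine_point + infinite_point)%type.

Implicit Types (P Q : hyperelliptic) (h : hyperelliptic -> R[i]).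

(* Coordinates of Q in the affine curve chosen around P: (x, y) if P is
   affine, (w, v) if P lies over infinity; None if Q is not on that curve. *)
Definition chart P Q : option (R[i] * R[i]) :=
  match P, Q with
  | inl _, inl q => Some (val q)
  | inl _, inr _ => None
  | inr _, inl q => if (val q).1 == 0 then None
                    else Some ((val q).1^-1, (val q).2 / (val q).1 ^+ g.+1)
  | inr _, inr v => Some (0, val v)
  end.

Definition near_point P (A : hyperelliptic -> Prop) : Prop :=
  match chart P P with
  | Some q0 => \forall q \near q0, forall Q, chart P Q = Some q -> A Q
  | None => False
  end.

(* The local coordinate t_P centered at P: on a smooth curve b^2 = F(a), it is
   a - a(P) where b(P) != 0, and b at the points where b(P) = 0. *)
Definition local_coord P Q : R[i] :=
  match chart P P, chart P Q with
  | Some (a0, b0), Some (a, b) => if b0 == 0 then b else a - a0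
  | _, _ => 0
  end.

Definition holomorphic_near0 (u : R[i] -> R[i]) : Prop :=
  \forall z \near (0 : R[i]), derivable u z 1.

(* h = t_P^n u(t_P) on a punctured neighbourhood of P, with u holomorphic and
   nonvanishing at 0.  A nonzero meromorphic function is a function having an
   order at each point; its values at its zeros and poles are irrelevant. *)
Definition has_order h P (n : int) : Prop :=
  exists u : R[i] -> R[i],
    [/\ holomorphic_near0 u, u 0 != 0 &
        near_point P (fun Q => Q != P ->
          h Q = local_coord P Q ^ n * u (local_coord P Q))].

(* The order at P of the 1-form h dx: writing x = xi(t_P) on a punctured
   neighbourhood of P, one has h dx = h xi'(t_P) dt_P.  Every meromorphic
   1-form is h dx for some function h.  (Points over infinity other than P do
   not occur close to P.) *)
Definition has_form_order h P (n : int) : Prop :=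
  exists u xi : R[i] -> R[i],
    [/\ holomorphic_near0 u, u 0 != 0 &
        near_point P (fun Q => Q != P ->
          match Q with
          | inl q => let t := local_coord P Q in
                     [/\ (val q).1 = xi t, derivable xi t 1 &
                         h Q * 'D_1 xi t = t ^ n * u t]
          | inr _ => True
          end)].

Definition divisor := {freeg hyperelliptic}.

Implicit Types (D E : divisor).

Definition linear_equiv D E : Prop :=
  exists h, forall P, has_order h P (coeff P (D - E)).

Definition canonical_divisor E : Prop :=
  exists h, forall P, has_form_order h P (coeff P E).

Definition is_spin_divisor (m : nat) D : Prop :=
  exists2 E, canonical_divisor E & linear_equiv (D *+ m) E.

Definition branch_set : set hyperelliptic :=
  [set P | match P with
           | inl q => exists i, val q = (e i, 0)
           | inr _ => N = (2 * g + 1)%N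
           end].

Definition supported_on_branch_set D : Prop :=
  exists2 E, linear_equiv D E & forall P, coeff P E != 0 -> branch_set P.

End Surface.

Arguments divisor {R} g {N} e.
Arguments hyperelliptic {R} g {N} e.
Arguments branch_set {R} g {N} e.

Definition k_min (g n : nat) : rat :=
  (g%:R * (n%:R - 1) + n%:R + 1) / (- (2%:R * n%:R)).

Definition k_max (g n : nat) : rat := (g%:R - 1) / (2%:R * n%:R).

(* The set S stands for the pairwise distinct indices i_1, i_2, ... *)
Definition admissible (g n : nat) (k : int) (S : {set 'I_(2 * g + 2)}) : Prop :=
  [/\ k_min g n <= k%:~R, k%:~R <= k_max g n &
      #|S|%:R = (g%:R - 1 - 2%:R * n%:R * k%:~R) / n%:R :> rat].

Definition branch_divisor (R : realType) (g N : nat) (e : 'I_N -> R[i])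
    (p : 'I_(2 * g + 2) -> hyperelliptic g e) (D : divisor g e)
    (k : int) (S : {set 'I_(2 * g + 2)}) : divisor g e :=
  D *~ k + \sum_(i in S) << p i >>.

(* Main.v *)
(* Every divisor supported on the branch points p_i is equivalent to kD plus
   a sum of distinct p_i, because 2 p_i ~ D (divisor of x - e_i), and S may be
   replaced by its complement because p_1 + ... + p_(2g+2) ~ (g + 1) D (divisor
   of y).  The canonical class is (g - 1) D (divisor of dx/y: the form h dx is
   turned into the function h y).

   Two facts forbid further relations.  Let h be a function whose divisor is
   supported on the branch points, and let h' be its conjugate under the
   hyperelliptic involution.
   - If the divisor of h is c p_i, then h h' is a function of x without poles
     (replacing h by its inverse if c < 0); it is constant, so c = 0.
   - The function h/h' + h'/h of x has no poles either, so it is constant; its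
     value at p_i is 2 (-1)^n, where n is the order of h at p_i.  Hence all
     these orders have the same parity.

   That a function of x which extends continuously to the Riemann sphere and
   is differentiable off a finite set is constant follows from Goursat's lemma
   for the form f (c + exp(s + i t)) (ds + i dt) on rectangles of height 2 pi:
   the mean of f over the circle of centre c and radius exp s does not depend
   on s, and it tends to f c and to f(oo) as s tends to -oo and +oo. *)
Require Import Defs.
From mathcomp Require Import all_boot all_order all_algebra.
From mathcomp Require Import complex freeg.
From mathcomp Require Import all_classical all_reals all_analysis.
From mathcomp Require Import ring lra zify.

Set Implicit Arguments.
Unset Strict Implicit.
Unset Printing Implicit Defensive.

Import Order.TTheory GRing.Theory Num.Theory numFieldNormedType.Exports.
Local Open Scope classical_set_scope.
Local Open Scope ring_scope.
Local Open Scope complex_scope.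

(** * Closed differential forms on rectangles *)

Section Goursat.
Context {R : realType}.
Implicit Types (a b c d x y : R) (f : R -> R).

(** A function [h] is known only through its local orders: nothing says that it is rational in x and
    y, and its values at its own zeros and poles are arbitrary. Functions of x are therefore built
    from it as symmetric expressions in its values at the two points over x. These points are told
    apart by a square root that is not continuous; the symmetry makes the choice of root harmless.
    At the branch points only limits of these expressions are controlled, which is why the constancy
    theorem must tolerate finitely many points of mere continuity: a circle through such a point is
    crossed by continuity of its mean. The exponential coordinates turn circles into segments, and
    periodicity cancels the two other sides of each rectangle. Degree arguments rest on the same
    constancy: a divisor is first moved onto a single branch point p_i, where c p_i ~ 0 forces c =
    0. *)

Definition intg f a b : R := \int[lebesgue_measure]_(x in `[a, b]) f x.

Lemma continuous_integrable_segment f a b : continuous f ->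
  lebesgue_measure.-integrable `[a, b] (EFin \o f).
Proof.
move=> cf; apply: continuous_compact_integrable; first exact: segment_compact.
exact: continuous_subspaceT.
Qed.

Lemma intg_split f x a b : continuous f -> a <= x -> x <= b ->
  intg f a b = intg f a x + intg f x b.
Proof.
move=> cf ax xb; have := @Rintegral_itvB R f (BLeft a) (BRight b) x.
rewrite !bnd_simp => /(_ (continuous_integrable_segment _ _ cf) ax xb) H.
rewrite /intg -(@Rintegral_itv_obnd_cbnd _ x (BRight b)); last first.
  apply: (integrableS _ _ _ (continuous_integrable_segment x b cf)) => //.
  exact: subset_itv_oc_cc.
by rewrite -H addrC subrK.
Qed.

(** One estimate for three uses: opposite sides of a rectangle ([k] is the slope times the gap),
    continuity in a parameter ([k = 0]), and closeness of a mean to a value ([h = 0]). *)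
Lemma le_intg_sub f h a b (k eta : R) : continuous f -> continuous h -> a <= b ->
  (forall x, a <= x <= b -> `|f x - h x - k| <= eta) ->
  `|intg f a b - intg h a b - k * (b - a)| <= eta * (b - a).
Proof.
move=> cf ch ab H.
have intc c : \int[lebesgue_measure]_(x in `[a, b]) c = c * (b - a) :> R.
  rewrite Rintegral_cst //= lebesgue_measure_itv /= lte_fin.
  by case: ltgtP ab => //= -> _; rewrite subrr.
rewrite -!intc /intg -RintegralB //; try exact: continuous_integrable_segment.
have cfh : continuous (fun x => f x - h x) by move=> x; exact: (cvgB (cf x) (ch x)).
have cc (z : R) : continuous (fun _ : R => z) by move=> x; exact: cvg_cst.
have cfhk : continuous (fun x => f x - h x - k).
  by move=> x; exact: (cvgB (cfh x) (cc k x)).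
rewrite -RintegralB //; try exact: continuous_integrable_segment.
apply: le_trans (le_normr_Rintegral _ _) _ => //; first exact: continuous_integrable_segment.
apply: le_Rintegral => //; try exact: continuous_integrable_segment.
  apply: (@continuous_integrable_segment (fun x => `|f x - h x - k|)) => x.
  by apply: cvg_norm; exact: cfhk.
Qed.

(** Total differentiability with gradient [(p1, p2)], not mere existence of partial derivatives; the
    remainder is measured in the sum norm. *)
Definition has_partials (P : R -> R -> R) x y (p1 p2 : R) : Prop :=
  forall eps : R, 0 < eps -> exists2 delta : R, 0 < delta &
    forall x' y', `|x' - x| < delta -> `|y' - y| < delta ->
      `|P x' y' - P x y - p1 * (x' - x) - p2 * (y' - y)|
        <= eps * (`|x' - x| + `|y' - y|).

(** The integral of the form P dx + Q dy along the boundary of [a, b] x [c, d], counterclockwise. *)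
Definition circulation (P Q : R -> R -> R) a b c d : R :=
  intg (P ^~ c) a b + intg (Q b) c d - intg (P ^~ d) a b - intg (Q a) c d.

Lemma circulation_splitx P Q x a b c d :
  (forall z, continuous (P ^~ z)) -> (forall z, continuous (Q z)) ->
  a <= x -> x <= b ->
  circulation P Q a b c d = circulation P Q a x c d + circulation P Q x b c d.
Proof.
move=> cP cQ ax xb; rewrite /circulation.
by rewrite (intg_split (cP c) ax xb) (intg_split (cP d) ax xb); ring.
Qed.

Lemma circulation_splity P Q y a b c d :
  (forall z, continuous (P ^~ z)) -> (forall z, continuous (Q z)) ->
  c <= y -> y <= d ->
  circulation P Q a b c d = circulation P Q a b c y + circulation P Q a b y d.
Proof.
move=> cP cQ cy yd; rewrite /circulation.
by rewrite (intg_split (cQ a) cy yd) (intg_split (cQ b) cy yd); ring.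
Qed.

(* Only the cross derivatives matter: the contributions of the two pairs of
   opposite sides cancel up to o(diameter^2). *)
Lemma circulation_small P Q x y (p1 r q2 eps : R) :
  (forall z, continuous (P ^~ z)) -> (forall z, continuous (Q z)) ->
  has_partials P x y p1 r -> has_partials Q x y r q2 -> 0 < eps ->
  exists2 delta : R, 0 < delta & forall a b c d,
    a <= x -> x <= b -> c <= y -> y <= d -> b - a < delta -> d - c < delta ->
    `|circulation P Q a b c d| <= eps * ((b - a) + (d - c)) ^+ 2.
Proof.
move=> cP cQ dP dQ e0.
have e20 : 0 < eps / 2 by rewrite divr_gt0.
have [d1 d10 H1] := dP _ e20; have [d2 d20 H2] := dQ _ e20.
exists (Num.min d1 d2); first by rewrite lt_min d10.
move=> a b c d ax xb cy yd; rewrite !lt_min => /andP[ba1 ba2] /andP[dc1 dc2].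
have ab : a <= b by lra.
have cd : c <= d by lra.
have nx s : a <= s <= b -> `|s - x| <= b - a.
  by move=> /andP[? ?]; rewrite ler_norml; apply/andP; split; lra.
have ny s : c <= s <= d -> `|s - y| <= d - c.
  by move=> /andP[? ?]; rewrite ler_norml; apply/andP; split; lra.
set L := b - a + (d - c).
have eP s t : a <= s <= b -> c <= t <= d ->
    `|P s t - P x y - p1 * (s - x) - r * (t - y)| <= eps / 2 * L.
  move=> hs ht; have := nx _ hs; have := ny _ ht => n1 n2.
  apply: le_trans (H1 _ _ _ _) _; try exact: le_lt_trans ba1 || exact: le_lt_trans dc1.
  by rewrite ler_pM2l //; apply: lerD.
have eQ s t : a <= s <= b -> c <= t <= d ->
    `|Q s t - Q x y - r * (s - x) - q2 * (t - y)| <= eps / 2 * L.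
  move=> hs ht; have := nx _ hs; have := ny _ ht => n1 n2.
  apply: le_trans (H2 _ _ _ _) _; try exact: le_lt_trans ba2 || exact: le_lt_trans dc2.
  by rewrite ler_pM2l //; apply: lerD.
have hc : c <= c <= d by rewrite lexx.
have hd : c <= d <= d by rewrite lexx andbT.
have ha : a <= a <= b by rewrite lexx.
have hb : a <= b <= b by rewrite lexx andbT.
have I1 : `|intg (P ^~ c) a b - intg (P ^~ d) a b - (r * (c - d)) * (b - a)|
   <= (eps * L) * (b - a).
  apply: le_intg_sub => // s hs.
  have := eP s c hs hc; have := eP s d hs hd.
  rewrite !ler_norml => /andP[u1 u2] /andP[u3 u4].
  by apply/andP; split; lra.
have I2 : `|intg (Q b) c d - intg (Q a) c d - (r * (b - a)) * (d - c)|
   <= (eps * L) * (d - c).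
  apply: le_intg_sub => // t ht.
  have := eQ a t ha ht; have := eQ b t hb ht.
  rewrite !ler_norml => /andP[u1 u2] /andP[u3 u4].
  by apply/andP; split; lra.
have -> : circulation P Q a b c d =
   (intg (P ^~ c) a b - intg (P ^~ d) a b - (r * (c - d)) * (b - a)) +
   (intg (Q b) c d - intg (Q a) c d - (r * (b - a)) * (d - c)).
  by rewrite /circulation; ring.
apply: le_trans (ler_normD _ _) _.
have -> : eps * L ^+ 2 = (eps * L) * (b - a) + (eps * L) * (d - c).
  by rewrite /L; ring.
exact: lerD.
Qed.

Section Bisection.
Variables (P Q : R -> R -> R).
Hypothesis cP : forall z, continuous (P ^~ z).
Hypothesis cQ : forall z, continuous (Q z).

Lemma circulation_quarter a c w h (K : R) : 0 <= w -> 0 <= h ->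
  K <= `|circulation P Q a (a + w) c (c + h)| ->
  exists q : R * R,
    [/\ a <= q.1, q.1 + w / 2 <= a + w, c <= q.2, q.2 + h / 2 <= c + h &
     K / 4 <= `|circulation P Q q.1 (q.1 + w / 2) q.2 (q.2 + h / 2)|].
Proof.
move=> w0 h0 HK.
pose F a c := circulation P Q a (a + w / 2) c (c + h / 2).
have E : circulation P Q a (a + w) c (c + h) =
   F a c + F a (c + h / 2) + F (a + w / 2) c + F (a + w / 2) (c + h / 2).
  rewrite (@circulation_splitx P Q (a + w / 2)) //; try lra.
  rewrite (@circulation_splity P Q (c + h / 2) a) //; try lra.
  rewrite (@circulation_splity P Q (c + h / 2) (a + w / 2)) //; try lra.
  have -> : a + w = a + w / 2 + w / 2 by lra.
  have -> : c + h = c + h / 2 + h / 2 by lra.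
  by rewrite /F addrA.
have [H1|H1] := leP (K / 4) `|F a c|; first by exists (a, c) => /=; split => //; lra.
have [H2|H2] := leP (K / 4) `|F a (c + h / 2)|.
  by exists (a, c + h / 2) => /=; split => //; lra.
have [H3|H3] := leP (K / 4) `|F (a + w / 2) c|.
  by exists (a + w / 2, c) => /=; split => //; lra.
have [H4|H4] := leP (K / 4) `|F (a + w / 2) (c + h / 2)|.
  by exists (a + w / 2, c + h / 2) => /=; split => //; lra.
exfalso; move: HK; rewrite E.
have := ler_normD (F a c + F a (c + h / 2) + F (a + w / 2) c) (F (a + w / 2) (c + h / 2)).
have := ler_normD (F a c + F a (c + h / 2)) (F (a + w / 2) c).
have := ler_normD (F a c) (F a (c + h / 2)).
lra.
Qed.

Lemma goursat a c w h : 0 <= w -> 0 <= h ->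
  (forall x y, a <= x <= a + w -> c <= y <= c + h -> exists p1 r q2,
     has_partials P x y p1 r /\ has_partials Q x y r q2) ->
  circulation P Q a (a + w) c (c + h) = 0.
Proof.
move=> w0 h0 H; apply/eqP/negPn/negP; rewrite -normr_gt0.
set K := `|_| => K0.
pose W n : R := w / 2 ^+ n; pose V n : R := h / 2 ^+ n.
have p2 n : 0 < 2 ^+ n :> R by rewrite exprn_gt0.
have W0 n : 0 <= W n by rewrite divr_ge0 // ltW.
have V0 n : 0 <= V n by rewrite divr_ge0 // ltW.
have WS n : W n.+1 = W n / 2 by rewrite /W exprSr invfM mulrA.
have VS n : V n.+1 = V n / 2 by rewrite /V exprSr invfM mulrA.
pose good n (q : R * R) := K / 4 ^+ n <=
  `|circulation P Q q.1 (q.1 + W n) q.2 (q.2 + V n)|.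
(* Stated as an implication under [exists], so that it holds for every [s] and [choice] yields a
   total successor function. *)
have step (s : nat * (R * R)) : exists q, good s.1 s.2 ->
   [/\ s.2.1 <= q.1, q.1 + W s.1.+1 <= s.2.1 + W s.1,
       s.2.2 <= q.2, q.2 + V s.1.+1 <= s.2.2 + V s.1 & good s.1.+1 q].
  have [gs|ngs] := pselect (good s.1 s.2); last by exists 0.
  have [q [q1 q2 q3 q4 q5]] := circulation_quarter (W0 s.1) (V0 s.1) gs.
  exists q => _; split; rewrite ?WS ?VS //.
  by rewrite /good WS VS exprSr invfM mulrA.
have [nxt Hnxt] := choice step.
pose q := fix q n := if n is m.+1 then nxt (m, q m) else (a, c).
have gq n : good n (q n).
  elim: n => [|n IH]; first by rewrite /good /W /V !expr0 !divr1.
  by have [] := Hnxt (n, q n) IH.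
have qS n := Hnxt (n, q n) (gq n).
have mono1 : nondecreasing_seq (fun n => (q n).1).
  by apply/nondecreasing_seqP => n; have [] := qS n.
have mono2 : nondecreasing_seq (fun n => (q n).2).
  by apply/nondecreasing_seqP => n; have [] := qS n.
have dec1 : nonincreasing_seq (fun n => (q n).1 + W n).
  by apply/nonincreasing_seqP => n; have [] := qS n.
have dec2 : nonincreasing_seq (fun n => (q n).2 + V n).
  by apply/nonincreasing_seqP => n; have [] := qS n.
have bd (u e : nat -> R) : nondecreasing_seq u -> (forall n, 0 <= e n) ->
    nonincreasing_seq (fun n => u n + e n) ->
    forall n, u n <= sup (range u) <= u n + e n.
  move=> mu e0 de n.
  have ub : ubound (range u) (u n + e n).
    move=> _ [m _ <-]; apply: (@le_trans _ _ (u (maxn m n))).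
      exact/mu/leq_maxl.
    apply: (@le_trans _ _ (u (maxn m n) + e (maxn m n))); first by rewrite lerDl.
    exact/de/leq_maxr.
  apply/andP; split.
    by apply: ub_le_sup; [exists (u n + e n) | exists n].
  by apply: ge_sup => //; exists (u 0%N), 0%N.
(* The lower left corners increase and the upper right ones decrease, so the suprema give a point
   common to all rectangles. *)
set x := sup (range (fun n => (q n).1)); set y := sup (range (fun n => (q n).2)).
have hx n : (q n).1 <= x <= (q n).1 + W n by exact: bd.
have hy n : (q n).2 <= y <= (q n).2 + V n by exact: bd.
have [p1 [r [q2 [dP dQ]]]] : exists p1 r q2,
     has_partials P x y p1 r /\ has_partials Q x y r q2.
  apply: H; first by have := hx 0%N; rewrite /W expr0 divr1.
  by have := hy 0%N; rewrite /V expr0 divr1.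
(* With this [e] the n-th circulation is at most half of K / 4^n, against [good n]. The summand 1
   keeps the denominator positive when [w = h = 0]. *)
pose e := K / (2 * (w + h + 1) ^+ 2).
have wh : 0 < (w + h + 1) ^+ 2 by rewrite exprn_gt0 //; lra.
have e0 : 0 < e by rewrite divr_gt0 // mulr_gt0.
have [dl dl0 Hs] := circulation_small cP cQ dP dQ e0.
have [n Hn] : exists n, (w + h) / 2 ^+ n < dl.
  have := cvg_geometric (w + h) (_ : `|2^-1| < 1 :> R).
  rewrite ger0_norm ?invr_ge0 // invf_lt1 // ltr1n => /(_ isT).
  move=> /cvgrPdist_lt/(_ _ dl0)[n _ /(_ n (leqnn n))].
  rewrite sub0r normrN ger0_norm => [Hn|]; first by exists n; rewrite /geometric /= exprVn in Hn.
  by rewrite /geometric /= mulr_ge0 ?exprn_ge0 ?invr_ge0 //; lra.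
have Wn : W n < dl.
  by apply: le_lt_trans Hn; rewrite /W ler_pM2r ?invr_gt0 //; lra.
have Vn : V n < dl.
  by apply: le_lt_trans Hn; rewrite /V ler_pM2r ?invr_gt0 //; lra.
have /andP[x1 x2] := hx n; have /andP[y1 y2] := hy n.
have := Hs (q n).1 ((q n).1 + W n) (q n).2 ((q n).2 + V n) x1 x2 y1 y2.
rewrite !(addrC (_ (q n))) !addrK => /(_ Wn Vn).
have := gq n; rewrite /good => /le_trans g1.
rewrite !(addrC (W n)) !(addrC (V n)) => /g1.
have -> : (W n + V n) ^+ 2 = (w + h) ^+ 2 / 4 ^+ n.
  rewrite /W /V -mulrDl expr_div_n; congr (_ / _).
  by rewrite -exprM mulnC exprM; congr (_ ^+ _); rewrite -natrX.
rewrite mulrA ler_pM2r ?invr_gt0 ?exprn_gt0 //.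
move=> H1.
have eE : e * (w + h + 1) ^+ 2 = K / 2.
  by rewrite /e; field; rewrite gt_eqF //; lra.
have : e * (w + h) ^+ 2 <= e * (w + h + 1) ^+ 2.
  by rewrite ler_pM2l // ler_sqr ?nnegrE; lra.
lra.
Qed.

End Bisection.

Lemma tube_uniform (Q : R -> R -> R) s T (eps : R) :
  continuous (fun z : R * R => Q z.1 z.2) -> 0 < eps ->
  \forall s' \near s, forall y, 0 <= y <= T -> `|Q s' y - Q s y| <= eps.
Proof.
move=> cQ e0; have cpt : compact `[0, T] by exact: segment_compact.
have e20 : 0 < eps / 2 by rewrite divr_gt0.
have := (compact_near_coveringP _).1 cpt R (nbhs s)
  (fun s' y => `|Q s' y - Q s y| <= eps) _.
have H x : [set` `[0, T]] x -> \forall x' \near x & i \near s,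
    `|Q i x' - Q s x'| <= eps.
  move=> _; have /cvgrPdist_lt/(_ _ e20)[[A B]/= [nA nB] sAB] := cQ (s, x).
  exists (B, A) => //= -[y' s'] /= [By As].
  have h1 := sAB (s', y') (conj As By).
  have h2 := sAB (s, y') (conj (nbhs_singleton nA) By).
  move: h1 h2 => /=; rewrite !ltr_norml ler_norml => /andP[? ?] /andP[? ?].
  by apply/andP; split; lra.
move=> /(_ _ H) near_s; near=> s' => y hy.
have : [set` `[0, T]] `<=` (fun y => `|Q s' y - Q s y| <= eps) by near: s'.
by apply; rewrite /= in_itv.
Unshelve. all: by end_near. Qed.

Lemma continuous_pairl (F : R * R -> R) z : continuous F -> continuous (fun s => F (s, z)).
Proof.
move=> cF s; apply: (@continuous_comp _ _ _ (fun s => (s, z)) F); last exact: cF.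
exact: (cvg_pair cvg_id (cvg_cst _)).
Qed.

Lemma continuous_pairr (F : R * R -> R) z : continuous F -> continuous (fun s => F (z, s)).
Proof.
move=> cF s; apply: (@continuous_comp _ _ _ (pair z) F); last exact: cF.
exact: (cvg_pair (cvg_cst _) cvg_id).
Qed.

Lemma continuous_intg (Q : R -> R -> R) T : 0 <= T ->
  continuous (fun z : R * R => Q z.1 z.2) -> continuous (fun s => intg (Q s) 0 T).
Proof.
move=> T0 cQ s; apply/cvgrPdist_le => eps e0.
have cQs z : continuous (Q z) := continuous_pairr (z := z) cQ.
have e1 : 0 < eps / (T + 1) by rewrite divr_gt0 //; lra.
have H0 := tube_uniform s T cQ e1; near=> s'.
have H : forall y, 0 <= y <= T -> `|Q s' y - Q s y| <= eps / (T + 1) by near: s'.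
have := @le_intg_sub (Q s') (Q s) 0 T 0 (eps / (T + 1)) (cQs s') (cQs s) T0.
rewrite mul0r subr0 distrC => /(_ _)/le_trans; apply.
  by move=> y hy; rewrite subr0; exact: H.
by rewrite mulrAC ler_pdivrMr ?ler_pM2l //; lra.
Unshelve. all: by end_near. Qed.

(** Induction on [S]: once a point x is discarded, [M] is constant on each side of it, and
    continuity identifies both constants with [M x]. *)
Lemma eq_off_finite (M : R -> R) (S : seq R) : continuous M ->
  (forall s t, s <= t -> (forall x, s <= x <= t -> x \notin S) -> M s = M t) ->
  forall s t, M s = M t.
Proof.
move=> cM; elim: S => [H s t|x S IH H].
  by have [st|/ltW st] := leP s t; [|symmetry]; apply: H.
apply: IH => s t st nS.
have left_eq u : u <= x -> (forall y, u <= y < x -> y \notin S) -> M u = M x.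
  rewrite le_eqVlt => /predU1P[->//|ux] nSu.
  have c1 : M y @[y --> x^'-] --> M x by apply: cvg_at_left_filter; exact: cM.
  suff c2 : M y @[y --> x^'-] --> M u by exact: (cvg_unique _ c2 c1).
  apply: cvg_near_cst; near=> y; apply/esym.
  have uy : u < y by near: y; exact: nbhs_left_gt.
  have yx : y < x by near: y; exact: nbhs_left_lt.
  apply: H; first exact: ltW.
  move=> z /andP[uz zy]; rewrite in_cons negb_or lt_eqF ?(le_lt_trans zy) //=.
  by apply: nSu; rewrite uz (le_lt_trans zy).
have right_eq u : x <= u -> (forall y, x < y <= u -> y \notin S) -> M u = M x.
  rewrite le_eqVlt => /predU1P[->//|xu] nSu.
  have c1 : M y @[y --> x^'+] --> M x by apply: cvg_at_right_filter; exact: cM.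
  suff c2 : M y @[y --> x^'+] --> M u by exact: (cvg_unique _ c2 c1).
  apply: cvg_near_cst; near=> y.
  have yu : y < u by near: y; exact: nbhs_right_lt.
  have xy : x < y by near: y; exact: nbhs_right_gt.
  apply: H; first exact: ltW.
  move=> z /andP[yz zu]; rewrite in_cons negb_or gt_eqF ?(lt_le_trans xy) //=.
  by apply: nSu; rewrite zu (lt_le_trans xy).
have [xs|sx] := ltP x s.
  apply: H => // z /andP[sz zt]; rewrite in_cons negb_or gt_eqF ?(lt_le_trans xs) //=.
  by apply: nS; rewrite sz.
have [tx|xt] := ltP t x.
  apply: H => // z /andP[sz zt]; rewrite in_cons negb_or lt_eqF ?(le_lt_trans zt) //=.
  by apply: nS; rewrite sz.
rewrite (left_eq s) ?(right_eq t) // => y /andP[h1 h2]; apply: nS.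
  by rewrite (le_trans sx (ltW h1)).
by rewrite h1 (le_trans (ltW h2)).
Unshelve. all: by end_near. Qed.

(** The integrals of [P] along y = 0 and y = T cancel by periodicity, so a vanishing circulation
    equates the two vertical integrals. [S] collects abscissas: a whole vertical line is given up as
    soon as one point on it is singular. *)
Lemma period_integral_const (P Q : R -> R -> R) (T : R) (S : seq R) : 0 <= T ->
  (forall z, continuous (P ^~ z)) -> continuous (fun z : R * R => Q z.1 z.2) ->
  (forall s, P s 0 = P s T) ->
  (forall s y, s \notin S -> exists p1 r q2,
     has_partials P s y p1 r /\ has_partials Q s y r q2) ->
  forall s t, intg (Q s) 0 T = intg (Q t) 0 T.
Proof.
move=> T0 cP cQ per H; apply: (@eq_off_finite _ S); first exact: continuous_intg.
move=> s t st nS.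
have cQs z : continuous (Q z) := continuous_pairr (z := z) cQ.
have := @goursat P Q cP cQs s 0 (t - s) T.
rewrite subr_ge0 => /(_ st T0); rewrite addrC subrK add0r.
have HH x y : s <= x <= t -> 0 <= y <= T -> exists p1 r q2,
     has_partials P x y p1 r /\ has_partials Q x y r q2.
  by move=> hx _; apply/H/nS.
move=> /(_ HH); rewrite /circulation.
have -> : P ^~ 0 = P ^~ T by apply/funext.
lra.
Qed.

End Goursat.

(** * Functions on the Riemann sphere *)

Section ComplexAnalysis.
Context {R : realType}.
Local Notation C := R[i].
Local Notation Re := complex.Re.
Local Notation Im := complex.Im.
Local Notation normc := (@Normc.normc R).
Implicit Types (f : C -> C) (z w c l : C).

(** The norm of R[i] takes its values in R[i]; [normc] is the same modulus as a real number, which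
    linear arithmetic over [R] can handle. *)
Lemma normrE z : `|z| = (normc z)%:C. Proof. by []. Qed.

Lemma normc_ge0 z : 0 <= normc z.
Proof. by have := normr_ge0 z; rewrite normrE ler0c. Qed.

Lemma normc_ltE z (e : R) : (`|z| < e%:C) = (normc z < e).
Proof. by rewrite normrE ltcR. Qed.

Lemma normc_leE z (e : R) : (`|z| <= e%:C) = (normc z <= e).
Proof. by rewrite normrE lecR. Qed.

Lemma normr_Re_le z : `|Re z| <= normc z.
Proof. by rewrite -lecR -normrE normc_ge_Re. Qed.

Lemma normr_Im_le z : `|Im z| <= normc z.
Proof.
case: z => a b /=; rewrite -sqrtr_sqr ler_sqrt ?addr_ge0 ?sqr_ge0 //.
by rewrite lerDr sqr_ge0.
Qed.

Lemma normc_le_ReIm z : normc z <= `|Re z| + `|Im z|.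
Proof.
case: z => a b /=; rewrite -(ger0_norm (addr_ge0 (normr_ge0 a) (normr_ge0 b))).
rewrite -sqrtr_sqr ler_sqrt ?sqr_ge0 // sqrrD !real_normK ?num_real //.
by rewrite -addrA lerD2l lerDr mulrn_wge0 ?mulr_ge0.
Qed.

Lemma nbhs_normcP (P : set C) z : nbhs z P <->
  exists2 d : R, 0 < d & forall w, normc (w - z) < d -> P w.
Proof.
split.
  move=> /nbhs_normP[e /= e0 H]; exists (Re e); first by move: e0; rewrite ltcE /= => /andP[].
  move=> w hw; apply: H => /=; rewrite distrC.
  have -> : e = (Re e)%:C by rewrite RRe_real // gtr0_real.
  by rewrite normc_ltE.
move=> [d d0 H]; apply/nbhs_normP; exists d%:C => /=; first by rewrite ltcR.
by move=> w /=; rewrite distrC normc_ltE; exact: H.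
Qed.

Lemma cvg_normcP f z l : f w @[w --> z] --> l <-> forall e : R, 0 < e ->
  exists2 d : R, 0 < d & forall w, normc (w - z) < d -> normc (f w - l) < e.
Proof.
split=> [/cvgrPdistC_lt H e e0|H].
  have := H e%:C; rewrite ltcR => /(_ e0)/nbhs_normcP[d d0 Hd].
  by exists d => // w /Hd; rewrite normc_ltE.
apply/(@cvgrPdistC_lt _ _ _ _ (nbhs_filter z)) => e e0; apply/nbhs_normcP.
have eE : e = (Re e)%:C by rewrite RRe_real // gtr0_real.
rewrite eE ltcR in e0; have [d d0 Hd] := H _ e0.
by exists d => // w /Hd; rewrite eE normc_ltE.
Qed.

(** Multiplying out the difference quotient removes the punctured neighbourhood: the estimate also
    makes sense, trivially, at [w = 0]. *)
Lemma is_derive_normcP f z a : is_derive z 1 f a <->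
  forall e : R, 0 < e -> exists2 d : R, 0 < d & forall w, normc w < d ->
    normc (f (z + w) - f z - a * w) <= e * normc w.
Proof.
have E w : w != 0 -> a - w^-1 *: ((f \o shift z) (w *: 1) - f z) =
    - ((f (z + w) - f z - a * w) / w).
  move=> w0; rewrite /= [w *: 1]mulr1 [w + z]addrC.
  by rewrite [_ *: _]mulrC; field.
split.
  move=> [df Da] e e0.
  have /cvgrPdist_lt/(_ e%:C) := df; rewrite -/('D_1 f z) Da ltcR => /(_ e0).
  rewrite near_withinE => /nbhs_normcP[d d0 H]; exists d => // w hw.
  have [->|w0] := eqVneq w 0.
    by rewrite addr0 mulr0 !subrr Normc.normc0 mulr0.
  have hw' : normc (w - 0) < d by rewrite [w - 0]subr0.
  have := H w hw' w0; rewrite E // normrN normc_ltE.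
  rewrite Normc.normcM Normc.normcV ltr_pdivrMr; first exact: ltW.
  rewrite lt_def normc_ge0 andbT; apply: contra_neq w0; exact: Normc.eq0_normc.
move=> H.
suff Ha : h^-1 *: ((f \o shift z) (h *: 1) - f z) @[h --> (0 : C)^'] --> a.
  by apply: DeriveDef; [apply/cvg_ex; exists a | exact: cvg_lim Ha].
apply/cvgrPdist_le => e e0.
have eE : e = (Re e)%:C by rewrite RRe_real // gtr0_real.
rewrite eE ltcR in e0; have [d d0 Hd] := H _ e0.
rewrite near_withinE; apply/nbhs_normcP; exists d => // w; rewrite subr0 => hw w0.
rewrite E // normrN eE normc_leE Normc.normcM Normc.normcV ler_pdivrMr; first exact: Hd.
rewrite lt_def normc_ge0 andbT; apply: contra_neq w0; exact: Normc.eq0_normc.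
Qed.

Lemma derivable_continuous f z : derivable f z 1 -> {for z, continuous f}.
Proof. by move=> /derivable1_diffP/differentiable_continuous. Qed.

Lemma derivable_comp1 f (h : C -> C) z : derivable h z 1 -> derivable f (h z) 1 ->
  derivable (f \o h) z 1.
Proof.
move=> dh df; have Dh := (derivable1_diffP h z).1 dh.
have Df := (derivable1_diffP f (h z)).1 df.
apply: (derivable1_diffP (f \o h) z).2.
exact: (@differentiable_comp _ _ _ _ h f z Dh Df).
Qed.

(** * The complex exponential *)

Definition cexp z : C := (expR (Re z))%:C * (cos (Im z) +i* sin (Im z)).

Lemma cexpD z w : cexp (z + w) = cexp z * cexp w.
Proof.
case: z w => [a b] [c d]; rewrite /cexp /= expRD cosD sinD; simpc.
by congr (_ +i* _); ring.
Qed.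

Lemma normc_cexp z : normc (cexp z) = expR (Re z).
Proof.
rewrite /cexp Normc.normcM /= expr0n addr0 cos2Dsin2 sqrtr1 mulr1 sqrtr_sqr.
by rewrite gtr0_norm // expR_gt0.
Qed.

Lemma cexp_period (s : R) : cexp (s +i* (pi *+ 2)) = cexp (s +i* 0).
Proof. by rewrite /cexp /= cos2pi sin2pi cos0 sin0. Qed.

Lemma derive_eps (f : R -> R) (x df : R) : is_derive x 1 f df ->
  forall e : R, 0 < e -> exists2 d : R, 0 < d & forall h, `|h| < d ->
    `|f (x + h) - f x - df * h| <= e * `|h|.
Proof.
move=> [dfx <-] e e0.
have /cvgrPdist_lt/(_ _ e0) := dfx.
rewrite near_withinE => /nbhs_normP[d /= d0 H]; exists d => // h hd.
have [->|h0] := eqVneq h 0; first by rewrite addr0 mulr0 !subrr normr0 mulr0.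
have := H h; rewrite /ball_ /= sub0r normrN => /(_ hd h0) /ltW.
rewrite [h *: 1]mulr1 [h + x]addrC [_ *: (_ - _)]mulrC distrC.
have -> : (f (x + h) - f x) / h - 'D_1 f x = (f (x + h) - f x - 'D_1 f x * h) / h.
  by field.
by rewrite normrM normfV ler_pdivrMr ?normr_gt0.
Qed.

Lemma derivable_cexp z : derivable cexp z 1.
Proof.
suff H : is_derive z 1 cexp (cexp z) by case: H.
apply/is_derive_normcP => e e0.
have E w : cexp (z + w) - cexp z - cexp z * w = cexp z * (cexp w - 1 - w).
  by rewrite cexpD; ring.
(* The functional equation reduces the claim to the remainder at 0, which the four terms below bound
   by (1 + 2 + 2 + 1) k |w|; 8 leaves room, and exp(Re z) is the modulus of the factor [cexp z]. *)
pose k := e / (expR (Re z) * 8).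
have k0 : 0 < k by rewrite divr_gt0 // mulr_gt0 // expR_gt0.
have [d1 d10 H1] := derive_eps (is_derive_expR (0 : R)) k0.
have [d2 d20 H2] := derive_eps (is_derive_cos (0 : R)) k0.
have [d3 d30 H3] := derive_eps (is_derive_sin (0 : R)) k0.
have [d4 d40 H4] : exists2 d : R, 0 < d & forall h, `|h| < d -> `|expR h - 1| <= k.
  have := @continuous_expR R 0; rewrite /continuous_at expR0 => /cvgrPdist_lt/(_ _ k0).
  move=> /nbhs_normP[d /= d0 H]; exists d => // h hd.
  by rewrite distrC ltW //; apply: H => /=; rewrite /ball_ /= sub0r normrN.
have [d5 d50 H5] := derive_eps (is_derive_sin (0 : R)) ltr01.
pose d := Num.min 1 (Num.min d1 (Num.min d2 (Num.min d3 (Num.min d4 d5)))).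
exists d; first by rewrite !lt_min ltr01 d10 d20 d30 d40.
move=> w hw; rewrite E Normc.normcM normc_cexp.
have hR := normr_Re_le w; have hI := normr_Im_le w.
have := le_lt_trans hR hw; have := le_lt_trans hI hw.
rewrite !lt_min => /and5P[_ i1 i2 i3 /andP[i4 i5]] /and5P[r0 r1 r2 r3 /andP[r4 r5]].
have := H1 _ r1; have := H2 _ i2; have := H3 _ i3; have := H4 _ r4; have := H5 _ i5.
rewrite !add0r expR0 cos0 sin0 oppr0 !mul0r !mul1r !subr0 !addr0.
move: hR hI; set n := normc w; move: r0.
rewrite -[cexp w - 1 - w]/(_ : C).
have Wre : Re (cexp w - 1 - w) = (expR (Re w) - 1 - Re w) * cos (Im w)
    + (1 + Re w) * (cos (Im w) - 1).
  by rewrite /cexp; case: (w) => a b /=; simpc; rewrite /=; ring.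
have Wim : Im (cexp w - 1 - w) = (expR (Re w) - 1) * sin (Im w)
    + (sin (Im w) - Im w).
  by rewrite /cexp; case: (w) => a b /=; simpc; rewrite /=; ring.
have := normc_le_ReIm (cexp w - 1 - w); rewrite Wre Wim.
set a := Re w; set b := Im w => hN a1 an bn h5 h4 h3 h2 h1.
have n0 : 0 <= n by exact: normc_ge0.
have kn : 0 <= k * n by rewrite mulr_ge0 // ltW.
have ka : k * `|a| <= k * n by rewrite ler_pM2l.
have kb : k * `|b| <= k * n by rewrite ler_pM2l.
have cb : `|cos b| <= 1 by rewrite ler_norml cos_geN1 cos_le1.
have t1 : `|(expR a - 1 - a) * cos b| <= k * n.
  rewrite normrM -[k * n]mulr1; apply: ler_pM => //; exact: le_trans h1 _.
have t2 : `|(1 + a) * (cos b - 1)| <= 2 * (k * n).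
  rewrite normrM; apply: ler_pM => //; last exact: le_trans h2 _.
  by apply: le_trans (ler_normD _ _) _; rewrite normr1; lra.
have sb : `|sin b| <= 2 * n.
  have -> : sin b = (sin b - b) + b by ring.
  by apply: le_trans (ler_normD _ _) _; lra.
have t3 : `|(expR a - 1) * sin b| <= k * (2 * n) by rewrite normrM ler_pM.
have n1 : normc (cexp w - 1 - w) <= 8 * (k * n).
  apply: le_trans hN _.
  have := ler_normD ((expR a - 1 - a) * cos b) ((1 + a) * (cos b - 1)).
  have := ler_normD ((expR a - 1) * sin b) (sin b - b).
  lra.
apply: le_trans (_ : expR (Re z) * (8 * (k * n)) <= _).
  by rewrite ler_pM2l // expR_gt0.
have := expR_gt0 (Re z) => ez.
have -> : expR (Re z) * (8 * (k * n)) = e * n; last by [].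
by rewrite /k; field; rewrite gt_eqF.
Qed.

Lemma continuous_ReIm f : continuous f ->
  continuous (fun v : R * R => Re (f (v.1 +i* v.2))) /\
  continuous (fun v : R * R => Im (f (v.1 +i* v.2))).
Proof.
move=> cf; suff H (v : R * R) (e : R) : 0 < e -> \forall v' \near v,
    normc (f (v'.1 +i* v'.2) - f (v.1 +i* v.2)) < e.
  split=> v; apply/cvgrPdistC_lt => e /(H v); apply: filterS => v' hv'.
    by apply: le_lt_trans hv'; rewrite -raddfB; exact: normr_Re_le.
  by apply: le_lt_trans hv'; rewrite -raddfB; exact: normr_Im_le.
move=> e0; have /cvg_normcP/(_ _ e0)[d d0 Hd] := cf (v.1 +i* v.2).
have d20 : 0 < d / 2 by rewrite divr_gt0.
apply/nbhs_ballP; exists (d / 2) => //= -[s t] /= [].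
rewrite /ball /= !(distrC v.1) !(distrC v.2) => h1 h2.
apply: Hd; apply: le_lt_trans (normc_le_ReIm _) _ => /=; lra.
Qed.

(** The Cauchy-Riemann equations. The shared number [r] says that Im f ds + Re f dt, the imaginary
    part of f (ds + i dt), is closed; its integral along a vertical segment is that of Re f. *)
Lemma has_partials_ReIm f (s t : R) : derivable f (s +i* t) 1 -> exists p r : R,
  has_partials (fun s t => Im (f (s +i* t))) s t p r /\
  has_partials (fun s t => Re (f (s +i* t))) s t r (- p).
Proof.
move=> /derivableP; set a := 'D_1 f _ => /is_derive_normcP Ha; exists (Im a), (Re a).
suff H e : 0 < e -> exists2 d : R, 0 < d & forall s' t',
    `|s' - s| < d -> `|t' - t| < d ->
    normc (f (s' +i* t') - f (s +i* t) - a * ((s' - s) +i* (t' - t))) <=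
      e * (`|s' - s| + `|t' - t|).
  split=> e /H[d d0 Hd]; exists d => // s' t' hs ht; apply: le_trans (Hd _ _ hs ht).
    apply: le_trans (normr_Im_le _); rewrite le_eqVlt; apply/orP; left; apply/eqP.
    congr (`|_|); case: (a) (f _) (f _) => a1 a2 [b1 b2] [c1 c2] /=; simpc => /=; ring.
  apply: le_trans (normr_Re_le _); rewrite le_eqVlt; apply/orP; left; apply/eqP.
  congr (`|_|); case: (a) (f _) (f _) => a1 a2 [b1 b2] [c1 c2] /=; simpc => /=; ring.
move=> e0; have [d d0 Hd] := Ha _ e0; exists (d / 2); first by rewrite divr_gt0.
move=> s' t' hs ht.
have hn := normc_le_ReIm ((s' - s) +i* (t' - t)); rewrite /= in hn.
have := Hd ((s' - s) +i* (t' - t)).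
have -> : (s +i* t) + ((s' - s) +i* (t' - t)) = s' +i* t'.
  by simpc; congr (_ +i* _); ring.
move=> /(_ _)/le_trans; apply; last by rewrite ler_pM2l.
apply: le_lt_trans hn _; lra.
Qed.

Lemma Re_sphere_const f l (bad : seq C) : continuous f ->
  (forall z, z \notin bad -> derivable f z 1) ->
  (forall e : R, 0 < e -> exists r : R, forall z, r < normc z -> normc (f z - l) <= e) ->
  forall c, Re (f c) = Re l.
Proof.
move=> cf df fl c.
pose G w := f (c + cexp w).
have dE w : derivable (fun w => c + cexp w) w 1.
  by apply: derivableD; [exact: derivable_cst | exact: derivable_cexp].
have cG : continuous G.
  move=> w; apply: (@continuous_comp _ _ _ (fun w => c + cexp w) f); last exact: cf.
  exact: derivable_continuous.
have [cQ cP] := continuous_ReIm cG.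
(* These are the abscissas of the circles about [c] through a bad point. If [c] itself is bad it
   adds a meaningless value, which is harmless since [S] need only be large enough. *)
pose S := [seq ln (normc (b - c)) | b <- bad].
have T0 : 0 <= pi *+ 2 :> R by rewrite mulrn_wge0 // pi_ge0.
have Mc : forall s t, intg (fun y => Re (G (s +i* y))) 0 (pi *+ 2) =
    intg (fun y => Re (G (t +i* y))) 0 (pi *+ 2).
  apply: (@period_integral_const R (fun s y => Im (G (s +i* y)))
     (fun s y => Re (G (s +i* y))) _ S) => //.
  - by move=> z; exact: (continuous_pairl (z := z) cP).
  - by move=> s; rewrite /G cexp_period.
  - move=> s y nS.
    have dG : derivable G (s +i* y) 1.
      apply: (@derivable_comp1 f (fun w => c + cexp w)) => //; apply: df.
      apply: contra nS => nb; apply/mapP; exists (c + cexp (s +i* y)) => //.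
      by rewrite addrC addKr normc_cexp expRK.
    by have [p [r [h1 h2]]] := has_partials_ReIm dG; exists p, r, (- p).
have cQs s : continuous (fun y => Re (G (s +i* y))) := continuous_pairr (z := s) cQ.
(* The integral of 0 comes from taking [h = 0] in [le_intg_sub]; it occurs in both estimates below
   and cancels. *)
have mean s k (e : R) : (forall y, normc (G (s +i* y) - k) <= e) ->
    `|intg (fun y => Re (G (s +i* y))) 0 (pi *+ 2) - intg (fun=> 0) 0 (pi *+ 2)
       - Re k * (pi *+ 2)| <= e * (pi *+ 2).
  move=> H; have := @le_intg_sub R (fun y => Re (G (s +i* y))) (fun=> 0) 0 (pi *+ 2) (Re k) e.
  rewrite subr0; apply => //; first by move=> x; exact: cvg_cst.
  move=> y _; rewrite subr0 -raddfB; apply: le_trans (H y); exact: normr_Re_le.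
have pi20 : 0 < pi *+ 2 :> R by rewrite mulrn_wgt0 // pi_gt0.
apply/eqP; rewrite -subr_eq0 -normr_eq0 eq_le normr_ge0 andbT.
apply/ler_addgt0Pr => e e0; rewrite add0r.
have e20 : 0 < e / 2 by rewrite divr_gt0.
have [s Hs] : exists s, forall y, normc (G (s +i* y) - f c) <= e / 2.
  have /cvg_normcP/(_ _ e20)[d d0 Hd] := cf c.
  exists (ln (d / 2)) => y; apply/ltW/Hd.
  by rewrite addrC addKr normc_cexp /= lnK ?posrE; lra.
have [t Ht] : exists t, forall y, normc (G (t +i* y) - l) <= e / 2.
  have [r Hr] := fl _ e20.
  (* A point at this distance from [c] has modulus at least |r| + 1, hence greater than [r]. *)
  exists (ln (`|r| + normc c + 1)) => y; apply: Hr.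
  have n0 := normc_ge0 c; have r0 := normr_ge0 r; have r1 := ler_norm r.
  have : normc (cexp (ln (`|r| + normc c + 1) +i* y)) <=
      normc (c + cexp (ln (`|r| + normc c + 1) +i* y)) + normc c.
    have := le_normcD (c + cexp (ln (`|r| + normc c + 1) +i* y)) (- c).
    by rewrite (normcN c) [c + _]addrC addrK.
  by rewrite normc_cexp /= lnK ?posrE; lra.
have := mean _ _ _ Hs; have := mean _ _ _ Ht; rewrite (Mc t s).
set I := intg _ _ _ - _; rewrite !ler_norml => /andP[h1 h2] /andP[h3 h4].
have [h5 h6] : (Re (f c) - Re l) * (pi *+ 2) <= e * (pi *+ 2) /\
   - e * (pi *+ 2) <= (Re (f c) - Re l) * (pi *+ 2) by split; lra.
by move: h5 h6; rewrite !ler_pM2r // => -> ->.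
Qed.

Lemma sphere_const f l (bad : seq C) : continuous f ->
  (forall z, z \notin bad -> derivable f z 1) ->
  (forall e : R, 0 < e -> exists r : R, forall z, r < normc z -> normc (f z - l) <= e) ->
  forall c, f c = l.
Proof.
move=> cf df fl c; have h1 := Re_sphere_const cf df fl c.
(* Multiplication by -i turns the imaginary part into a real part. *)
have h2 : Re (- 'i * f c) = Re (- 'i * l).
  apply: (@Re_sphere_const (fun z => - 'i * f z) _ bad).
  - by move=> z; exact: (cvgM (cvg_cst _) (cf z)).
  - by move=> z nb; apply: derivableM; [exact: derivable_cst | exact: df].
  - move=> e /fl[r Hr]; exists r => z /Hr.
    rewrite -mulrBr Normc.normcM (_ : normc (- 'i) = 1) ?mul1r //.
    by rewrite /= !oppr0 expr0n add0r sqrrN expr1n sqrtr1.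
move: h1 h2; case: (f c) l {fl} => [a b] [a' b'] /= -> ; rewrite !(oppr0, mul0r) !sub0r.
by rewrite !mulN1r !opprK => ->.
Qed.

End ComplexAnalysis.

(** * Local complex analysis *)

Section LocalAnalysis.
Context {R : realType}.
Local Notation C := R[i].
Local Notation normc := (@Normc.normc R).
Implicit Types (f h u v : C -> C) (z w c l : C) (p : {poly C}).

Lemma normc_eq0 z : (normc z == 0) = (z == 0).
Proof. by apply/eqP/eqP => [/Normc.eq0_normc|->]; rewrite ?Normc.normc0. Qed.

Lemma normc_gt0 z : (0 < normc z) = (z != 0).
Proof. by rewrite lt_def normc_ge0 andbT normc_eq0. Qed.

Lemma normc_real (r : R) : normc r%:C = `|r|.
Proof. by rewrite /= expr0n addr0 sqrtr_sqr. Qed.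

Lemma ler_normcD z w : normc (z + w) <= normc z + normc w.
Proof. exact: le_normcD. Qed.

Lemma normc_dist z w : normc (z - w) = normc (w - z).
Proof. by rewrite -opprB; exact: normcN. Qed.

Lemma normc_triangle w z c : normc (z - c) <= normc (z - w) + normc (w - c).
Proof. by rewrite (_ : z - c = (z - w) + (w - c)) ?ler_normcD //; ring. Qed.

Lemma normc_small z : (forall e : R, 0 < e -> normc z <= e) -> z = 0.
Proof.
move=> H; apply/eqP; rewrite -normc_eq0 eq_le normc_ge0 andbT.
by apply/ler_addgt0Pr => e /H; rewrite add0r.
Qed.

(** A punctured limit: an order describes a function only off the point, so the value at [c] must
    not count. *)
Definition plim f c l := forall e : R, 0 < e -> exists2 d : R, 0 < d &
  forall w, w != c -> normc (w - c) < d -> normc (f w - l) < e.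

(** Comparing a limit at z with a limit at c takes a witness distinct from both; of z + d/2 and z +
    d/3 at most one equals c. *)
Lemma nearby_point z c (d : R) : 0 < d ->
  exists w, [/\ w != z, w != c & normc (w - z) < d].
Proof.
move=> d0; have E (k : R) : 0 < k < d -> z + k%:C != z /\ normc (z + k%:C - z) < d.
  move=> /andP[k0 kd]; rewrite addrC addrK normc_real gtr0_norm //; split=> //.
  by rewrite -subr_eq0 addrK -normc_eq0 normc_real gtr0_norm ?gt_eqF.
have [h1 h2] : z + (d / 2)%:C != z /\ normc (z + (d / 2)%:C - z) < d.
  by apply: E; apply/andP; split; lra.
have [h3 h4] : z + (d / 3)%:C != z /\ normc (z + (d / 3)%:C - z) < d.
  by apply: E; apply/andP; split; lra.
have [e1|] := eqVneq (z + (d / 2)%:C) c; last by exists (z + (d / 2)%:C).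
exists (z + (d / 3)%:C); split=> //; rewrite -e1 (inj_eq (addrI _)).
by apply/eqP => /complexI; lra.
Qed.

Lemma plim_unique f c l l' : plim f c l -> plim f c l' -> l = l'.
Proof.
move=> H H'; apply/eqP; rewrite -subr_eq0; apply/eqP/normc_small => e e0.
have e20 : 0 < e / 2 by rewrite divr_gt0.
have [d d0 Hd] := H _ e20; have [d' d'0 Hd'] := H' _ e20.
have m0 : 0 < Num.min d d' by rewrite lt_min d0.
have [w [wc _]] := nearby_point c c m0; rewrite lt_min => /andP[/(Hd w wc) h1 /(Hd' w wc) h2].
have := normc_triangle (f w) l l'; rewrite (normc_dist l (f w)); lra.
Qed.

Lemma continuous_plim f c : {for c, continuous f} -> plim f c (f c).
Proof. by move=> /cvg_normcP H e /H[d d0 Hd]; exists d => // w _; exact: Hd. Qed.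

Lemma eq_plim f h c l (d : R) : 0 < d ->
  (forall w, w != c -> normc (w - c) < d -> f w = h w) -> plim f c l -> plim h c l.
Proof.
move=> d0 E H e /H[d' d'0 Hd]; exists (Num.min d d'); first by rewrite lt_min d0.
by move=> w wc; rewrite lt_min => /andP[wd wd']; rewrite -E //; exact: Hd.
Qed.

Lemma plim_comp f h c l (b : C) (d : R) : 0 < d ->
  plim h c b -> plim f b l -> (forall w, w != c -> normc (w - c) < d -> h w != b) ->
  plim (f \o h) c l.
Proof.
move=> d0 Hh Hf hb e /Hf[d1 d10 /= H1]; have [d2 d20 H2] := Hh _ d10.
exists (Num.min d d2); first by rewrite lt_min d0.
by move=> w wc; rewrite lt_min => /andP[wd wd']; apply: H1; [exact: hb|exact: H2].
Qed.

Lemma plim_continuous (f lc : C -> C) : (forall c, plim f c (lc c)) -> continuous lc.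
Proof.
move=> flc c; apply/cvg_normcP => e e0.
have e20 : 0 < e / 2 by rewrite divr_gt0.
have [d d0 Hd] := flc c _ e20; exists d => // z zd.
have [d' d'0 Hd'] := flc z _ e20.
have m0 : 0 < Num.min d' (d - normc (z - c)) by rewrite lt_min d'0 subr_gt0.
have [w [wz wc]] := nearby_point z c m0; rewrite lt_min => /andP[/(Hd' w wz) h1 h2].
have /(Hd w wc) h3 : normc (w - c) < d by have := normc_triangle z w c; lra.
have := normc_triangle (f w) (lc z) (lc c); rewrite (normc_dist (lc z) (f w)); lra.
Qed.

(* Riemann's removable singularity theorem is avoided: at the points of [bad],
   continuity of [lc] suffices for [sphere_const]. *)
Lemma plim_sphere_const (f lc : C -> C) l (bad : seq C) :
  (forall c, plim f c (lc c)) ->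
  (forall c, c \notin bad -> exists v, exists2 d : R, 0 < d &
     forall w, normc (w - c) < d -> derivable v w 1 /\ (w != c -> f w = v w)) ->
  (forall e : R, 0 < e -> exists r : R, forall z, r < normc z -> normc (f z - l) <= e) ->
  forall c, lc c = l.
Proof.
move=> flc fv fl; apply: (@sphere_const R lc l bad).
- exact: plim_continuous flc.
- move=> c /fv[v [d d0 H]].
  have Hv z : normc (z - c) < d -> v z = lc z.
    move=> zd; have [dv _] := H z zd.
    have cv := continuous_plim (derivable_continuous dv).
    apply: (plim_unique cv).
    have [zc|zc] := eqVneq z c.
      rewrite zc; apply: (@eq_plim f _ _ _ d) => // w wc /H[_]; exact.
    pose m := Num.min (normc (z - c)) (d - normc (z - c)).
    apply: (@eq_plim f _ _ _ m) => //; first by rewrite lt_min subr_gt0 zd normc_gt0 subr_eq0 zc.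
    move=> w wz; rewrite lt_min => /andP[w1 w2].
    have wd : normc (w - c) < d by have := normc_triangle z w c; lra.
    apply: (H w wd).2; apply: contraTneq w1 => ->; by rewrite -leNgt normc_dist.
  apply: (@near_eq_derivable _ _ _ v).
    by apply/nbhs_normcP; exists d.
  by apply: (H c _).1; rewrite subrr Normc.normc0.
- move=> e e0; have e20 : 0 < e / 2 by rewrite divr_gt0.
  have [r Hr] := fl _ e20; exists r => z rz.
  have [d d0 Hd] := flc z _ e20.
  have m0 : 0 < Num.min d (normc z - r) by rewrite lt_min d0 subr_gt0.
  have [w [wz _]] := nearby_point z z m0; rewrite lt_min => /andP[/(Hd w wz) h1 h2].
  have /Hr h3 : r < normc w.
    have := ler_normcD (z - w) w; rewrite subrK (normc_dist z w); lra.
  have := normc_triangle (f w) (lc z) l; rewrite (normc_dist (lc z) (f w)); lra.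
Qed.

(** At [c = 0] this unfolds to [holomorphic_near0], so the witnesses of orders can be used as they
    are. *)
Definition hol_at f c := \forall z \near c, derivable f z 1.

Lemma hol_at_derivable f c : hol_at f c -> derivable f c 1.
Proof. exact: nbhs_singleton. Qed.

Lemma hol_at_continuous f c : hol_at f c -> {for c, continuous f}.
Proof. by move=> /hol_at_derivable/derivable_continuous. Qed.

Lemma hol_at_all f c : (forall z, derivable f z 1) -> hol_at f c.
Proof. by move=> df; apply: filterE. Qed.

Lemma hol_at_cst l c : hol_at (fun=> l) c.
Proof. by apply: hol_at_all => z; exact: derivable_cst. Qed.

Lemma hol_at_id c : hol_at (fun z => z) c.
Proof. by apply: hol_at_all => z; exact: derivable_id. Qed.

Lemma hol_atD f h c : hol_at f c -> hol_at h c -> hol_at (fun z => f z + h z) c.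
Proof.
move=> hf hh; apply: filterS2 hf hh => z df dh.
exact: (@derivableD _ _ _ f h z 1 df dh).
Qed.

Lemma hol_atN f c : hol_at f c -> hol_at (fun z => - f z) c.
Proof. by move=> hf; apply: filterS hf => z df; exact: (@derivableN _ _ _ f z 1 df). Qed.

Lemma hol_atB f h c : hol_at f c -> hol_at h c -> hol_at (fun z => f z - h z) c.
Proof. by move=> hf hh; exact: (hol_atD hf (hol_atN hh)). Qed.

Lemma hol_atM f h c : hol_at f c -> hol_at h c -> hol_at (fun z => f z * h z) c.
Proof.
move=> hf hh; apply: filterS2 hf hh => z df dh.
exact: (@derivableM _ _ f h z 1 df dh).
Qed.

Lemma near_neq0 f c : {for c, continuous f} -> f c != 0 -> \forall z \near c, f z != 0.
Proof.
move=> /cvg_normcP cf fc0; rewrite -normc_gt0 in fc0.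
have [d d0 Hd] := cf _ fc0; apply/nbhs_normcP; exists d => // w /Hd.
by apply: contraTneq => ->; rewrite sub0r (normcN (f c)) ltxx.
Qed.

Lemma hol_atV f c : hol_at f c -> f c != 0 -> hol_at (fun z => (f z)^-1) c.
Proof.
move=> hf f0; have fn0 := near_neq0 (hol_at_continuous hf) f0.
apply: filterS2 hf fn0 => z df fz0.
exact: (@derivableV _ _ f z 1 fz0 df).
Qed.

Lemma hol_atX f n c : hol_at f c -> hol_at (fun z => f z ^+ n) c.
Proof.
move=> hf; elim: n => [|n IH].
  by under eq_fun do rewrite expr0; exact: hol_at_cst.
by under eq_fun do rewrite exprS; exact: (hol_atM hf IH).
Qed.

Lemma near_comp (P : set C) f c b : {for c, continuous f} -> f c = b ->
  (\forall w \near b, P w) -> \forall z \near c, P (f z).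
Proof. by move=> cf <-; exact: cf. Qed.

Lemma hol_at_comp f h c b : hol_at h c -> h c = b -> hol_at f b ->
  hol_at (fun z => f (h z)) c.
Proof.
move=> hh hb hf; have hfh := near_comp (hol_at_continuous hh) hb hf.
apply: filterS2 hh hfh => z dh df.
exact: (@derivable_comp1 _ f h z dh df).
Qed.

Lemma is_derive1M f h z a b : is_derive z 1 f a -> is_derive z 1 h b ->
  is_derive z 1 (fun w => f w * h w) (f z * b + h z * a).
Proof. by move=> df dh; exact: is_deriveM. Qed.

Lemma is_derive1_horner p z : is_derive z 1 (horner p) p^`().[z].
Proof.
elim/poly_ind: p => [|p c IH].
  rewrite deriv0 horner0 (_ : horner 0 = cst 0); first exact: is_derive_cst.
  by apply/funext => y; rewrite horner0.
rewrite derivD derivC addr0 derivM derivX mulr1 hornerD hornerM hornerX.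
rewrite (_ : horner (p * 'X + c%:P) = (fun w => p.[w] * w + c)); last first.
  by apply/funext => y; rewrite !hornerE.
rewrite -[_ * z + _]addr0.
apply: (@is_deriveD _ _ _ (fun w => p.[w] * w) (cst c)).
by rewrite addrC -[X in X + _]mulr1 [_ * z]mulrC; exact: is_derive1M.
Qed.

Lemma hol_at_horner p c : hol_at (horner p) c.
Proof. by apply: hol_at_all => z; have [] := is_derive1_horner p z. Qed.

Lemma is_derive1_compc f h z a b : is_derive (h z) 1 f a -> is_derive z 1 h b ->
  is_derive z 1 (fun w => f (h w)) (a * b).
Proof.
move=> /is_derive_normcP Hf Hh; have [dh _] := Hh; move/is_derive_normcP: Hh => Hh.
apply/is_derive_normcP => e e0.
have nb := normc_ge0 b; have na := normc_ge0 a.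
(* The error splits into f's remainder at the increment k of h, and a times h's remainder. Since
   [e2 <= 1], |k| <= (|b| + 1) |w|; the two constants then give e/2 to each part. *)
pose e1 := e / (2 * (normc b + 1)).
have e10 : 0 < e1 by rewrite divr_gt0 // mulr_gt0 //; lra.
pose e2 := Num.min 1 (e / (2 * (normc a + 1))).
have e20 : 0 < e2 by rewrite lt_min ltr01 divr_gt0 // mulr_gt0 //; lra.
have [d1 d10 H1] := Hf _ e10; have [d2 d20 H2] := Hh _ e20.
have /cvg_normcP/(_ _ d10)[d3 d30 H3] := derivable_continuous dh.
exists (Num.min d2 d3); first by rewrite lt_min d20.
move=> w; rewrite lt_min => /andP[/H2 h2 w3].
have h3 : normc (h (z + w) - h z) < d1 by apply: H3; rewrite addrC addKr.
have := H1 _ h3; rewrite [h z + _]addrC subrK.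
set k := h (z + w) - h z in h2 h3 *; set n := normc w in h2 *.
have n0 : 0 <= n by exact: normc_ge0.
have e21 : e2 * n <= n by rewrite ler_piMl // ge_min lexx.
have kn : normc k <= (normc b + 1) * n.
  by have := ler_normcD (k - b * w) (b * w); rewrite subrK Normc.normcM -/n; lra.
have k1 : e1 * normc k <= e / 2 * n.
  apply: le_trans (_ : e1 * ((normc b + 1) * n) <= _); first by rewrite ler_pM2l.
  by rewrite le_eqVlt; apply/orP; left; apply/eqP; rewrite /e1; field; rewrite gt_eqF //; lra.
have k2 : normc a * normc (k - b * w) <= e / 2 * n.
  apply: le_trans (_ : (normc a + 1) * (e2 * n) <= _).
    by rewrite ler_pM ?normc_ge0 //; lra.
  rewrite mulrA ler_wpM2r // mulrC -ler_pdivlMr; last by lra.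
  rewrite ge_min; apply/orP; right.
  by rewrite le_eqVlt; apply/orP; left; apply/eqP; field; rewrite gt_eqF //; lra.
move=> h4.
rewrite (_ : f (h (z + w)) - f (h z) - a * b * w =
  (f (h (z + w)) - f (h z) - a * k) + a * (k - b * w)); last by ring.
apply: le_trans (ler_normcD _ _) _; rewrite Normc.normcM; lra.
Qed.

(** * Polynomials near a simple root *)

Lemma normc_prod (I : Type) (s : seq I) (F : I -> C) :
  normc (\prod_(j <- s) F j) = \prod_(j <- s) normc (F j).
Proof.
elim: s => [|j s IH]; first by rewrite !big_nil Normc.normc1.
by rewrite !big_cons Normc.normcM IH.
Qed.

(** Bound and Lipschitz constant are proved together because the Lipschitz estimate for [p * 'X + c]
    uses the bound on [p]. *)
Lemma horner_lipschitz p (r : R) : exists2 L : R, 0 <= L & forall x y,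
  normc x <= r -> normc y <= r ->
  normc p.[x] <= L /\ normc (p.[x] - p.[y]) <= L * normc (x - y).
Proof.
have [r0|r0] := leP 0 r; last first.
  by exists 0 => // x y xr; have := normc_ge0 x; lra.
elim/poly_ind: p => [|p c [L L0 IH]].
  by exists 0 => // x y _ _; rewrite !horner0 subrr Normc.normc0 mul0r.
exists (L * r + normc c + L); first by rewrite !addr_ge0 ?mulr_ge0 ?normc_ge0.
move=> x y xr yr; have [h1 h2] := IH _ _ xr yr; have [h3 _] := IH _ _ yr xr.
rewrite !hornerE; split.
  apply: le_trans (ler_normcD _ _) _; rewrite Normc.normcM.
  have : normc p.[x] * normc x <= L * r by rewrite ler_pM ?normc_ge0.
  lra.
rewrite (_ : _ - _ = (p.[x] - p.[y]) * x + p.[y] * (x - y)); last by ring.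
apply: le_trans (ler_normcD _ _) _; rewrite !Normc.normcM.
have h4 : normc (p.[x] - p.[y]) * normc x <= L * normc (x - y) * r.
  by rewrite ler_pM ?normc_ge0.
have h5 : normc p.[y] * normc (x - y) <= L * normc (x - y).
  by rewrite ler_wpM2r ?normc_ge0.
have h6 : 0 <= normc c * normc (x - y) by rewrite mulr_ge0 ?normc_ge0.
rewrite !mulrDl; lra.
Qed.

(** Algebraic closure replaces a fixed point argument: if all roots of p - z were at distance at
    least d from c, the factorization would give |z| = |p(c) - z| >= |lead_coef p| d^deg p. *)
Lemma horner_root_near p c (d : R) : p.[c] = 0 -> p^`().[c] != 0 -> 0 < d ->
  \forall z \near 0, exists2 x, normc (x - c) < d & p.[x] = z.
Proof.
move=> pc dpc d0.
have sp : (1 < size p)%N.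
  rewrite ltnNge; apply: contra dpc => /size1_polyC ->.
  by rewrite derivC horner0.
have lc z : lead_coef (p - z%:P) = lead_coef p.
  by rewrite lead_coefDl // size_polyN (leq_ltn_trans (size_polyC_leq1 _)).
have sz z : size (p - z%:P) = size p.
  by rewrite size_polyDl // size_polyN (leq_ltn_trans (size_polyC_leq1 _)).
have lp0 : lead_coef p != 0.
  by rewrite lead_coef_eq0 -size_poly_eq0 -lt0n; exact: ltnW.
pose k := normc (lead_coef p) * d ^+ (size p).-1.
have k0 : 0 < k by rewrite mulr_gt0 ?normc_gt0 ?exprn_gt0.
apply/nbhs_normcP; exists k => // z; rewrite subr0 => zk.
have [s Hs] := closed_field_poly_normal (p - z%:P).
have ss : size s = (size p).-1.
  move: (congr1 (fun q : {poly C} => size q) Hs).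
  by rewrite sz lc size_scale // size_prod_XsubC => ->.
have [/hasP[x xs hx]|/hasPn no] := boolP (has (fun x => normc (x - c) < d) s).
  exists x => //; apply/eqP; rewrite -subr_eq0.
  rewrite (_ : p.[x] - z = (p - z%:P).[x]); last by rewrite !hornerE.
  rewrite Hs hornerZ horner_prod mulf_eq0; apply/orP; right.
  by rewrite prodf_seq_eq0; apply/hasP; exists x => //=; rewrite !hornerE subrr.
exfalso; move: zk; apply/negP; rewrite -leNgt /k -(lc z).
have -> : normc z = normc (p - z%:P).[c].
  by rewrite !hornerE pc sub0r; rewrite (normcN z).
rewrite [in leRHS]Hs hornerZ Normc.normcM horner_prod normc_prod.
rewrite ler_pM2l; last by rewrite normc_gt0 lc.
rewrite -ss; elim: s no {Hs ss} => [|x s IH] no; first by rewrite big_nil expr0.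
rewrite big_cons exprS ler_pM ?exprn_ge0 ?(ltW d0) //.
  by rewrite !hornerE normc_dist leNgt; apply: no; rewrite mem_head.
by apply: IH => y ys; apply: no; rewrite in_cons ys orbT.
Qed.

Lemma horner_expanding p c : p.[c] = 0 -> p^`().[c] != 0 ->
  exists k d : R, [/\ 0 < k, 0 < d & forall x y,
    normc (x - c) < d -> normc (y - c) < d ->
    k * normc (x - y) <= normc (p.[x] - p.[y])].
Proof.
move=> pc dpc.
have [q pE] : exists q, p = p^`().[c] *: ('X - c%:P) + ('X - c%:P) ^+ 2 * q.
  have /factor_theorem[q1 E1] : root p c by rewrite /root pc.
  have dE : p^`().[c] = q1.[c].
    by rewrite E1 derivM derivXsubC !hornerE subrr mulr0 add0r.
  have /factor_theorem[q E] : root (q1 - q1.[c]%:P) c by rewrite /root !hornerE subrr.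
  exists q; rewrite {1}E1 dE -mul_polyC -[q1 in LHS](subrK q1.[c]%:P) E; ring.
have [L L0 HL] := horner_lipschitz q (normc c + 1).
set a := p^`().[c] in dpc pE *; have a0 : 0 < normc a by rewrite normc_gt0.
(* In p(x) - p(y) the quadratic part is at most (X + 2Y) L |x - y| <= 3 d L |x - y|, that is at most
   half of |a| |x - y|. The bound [d <= 1] keeps x and y in the disc where [L] is valid. *)
pose d := Num.min 1 (normc a / (2 * (3 * L + 1))).
have d0 : 0 < d by rewrite lt_min ltr01 divr_gt0 // mulr_gt0 //; lra.
exists (normc a / 2), d; split=> //; first by rewrite divr_gt0.
move=> x y xd yd.
have nb w : normc (w - c) < d -> normc w <= normc c + 1.
  by rewrite lt_min => /andP[w1 _]; have := ler_normcD (w - c) c; rewrite subrK; lra.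
have [h1 h2] := HL _ _ (nb _ xd) (nb _ yd).
have [d1 dL] : d <= 1 /\ d * (3 * L) <= normc a / 2.
  split; first by rewrite ge_min lexx.
  have : d * (2 * (3 * L + 1)) <= normc a.
    by rewrite -ler_pdivlMr ?ge_min ?lexx ?orbT //; lra.
  lra.
have E : p.[x] - p.[y] = a * (x - y) + ((x - y) * ((x - c) + (y - c)) * q.[x]
    + (y - c) ^+ 2 * (q.[x] - q.[y])).
  have pEw w : p.[w] = a * (w - c) + (w - c) ^+ 2 * q.[w].
    by rewrite [in LHS]pE !hornerE.
  by rewrite !pEw; ring.
set X := normc (x - c) in xd; set Y := normc (y - c) in yd; set n := normc (x - y).
have X0 : 0 <= X by exact: normc_ge0.
have Y0 : 0 <= Y by exact: normc_ge0.
have n0 : 0 <= n by exact: normc_ge0.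
have b1 : normc ((x - y) * ((x - c) + (y - c)) * q.[x]) <= n * (X + Y) * L.
  rewrite !Normc.normcM ler_pM ?mulr_ge0 ?normc_ge0 //.
  by rewrite ler_wpM2l ?normc_ge0 // ler_normcD.
have b2 : normc ((y - c) ^+ 2 * (q.[x] - q.[y])) <= Y * (L * n).
  rewrite Normc.normcM expr2 Normc.normcM ler_pM ?mulr_ge0 ?normc_ge0 //.
  by rewrite -/Y ler_piMl //; lra.
set A := (x - y) * _ * _ in E b1 *; set B := _ ^+ 2 * _ in E b2 *.
have b3 : normc a * n <= normc (p.[x] - p.[y]) + (normc A + normc B).
  rewrite -Normc.normcM (_ : a * (x - y) = p.[x] - p.[y] - (A + B)); last by rewrite E addrK.
  apply: le_trans (ler_normcD _ _) _; rewrite lerD2l; rewrite (normcN (A + B)).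
  exact: ler_normcD.
have b4 : (X + Y + Y) * (L * n) <= (d * 3) * (L * n).
  by rewrite ler_wpM2r ?mulr_ge0 //; lra.
have b5 : d * (3 * L) * n <= normc a / 2 * n by rewrite ler_wpM2r.
lra.
Qed.

(** The inverse function theorem for a polynomial: [horner_root_near] gives surjectivity onto a
    small disc, and [horner_expanding] injectivity together with the bound |w| / k on the increments
    of the inverse. *)
Lemma horner_local_inverse p c : p.[c] = 0 -> p^`().[c] != 0 ->
  exists xi : C -> C, [/\ hol_at xi 0, xi 0 = c,
    \forall x \near c, xi p.[x] = x & \forall z \near 0, p.[xi z] = z].
Proof.
move=> pc dpc; have [k [d [k0 d0 Hk]]] := horner_expanding pc dpc.
have [d1 d10 Hd1] : exists2 d1 : R, 0 < d1 & forall x, normc (x - c) < d1 -> p^`().[x] != 0.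
  by apply/nbhs_normcP/near_neq0 => //; exact/hol_at_continuous/hol_at_horner.
pose e := Num.min d d1; have e0 : 0 < e by rewrite lt_min d0.
have [/= r r0 Hr] := (nbhs_normcP _ _).1 (horner_root_near pc dpc e0).
pose xi z := xget c [set x | normc (x - c) < e /\ p.[x] = z].
have xiE x z : normc (x - c) < e -> p.[x] = z -> xi z = x.
  move=> xe pz; have [] : [set x | normc (x - c) < e /\ p.[x] = z] (xi z).
    by apply: (@xgetPex _ c [set x | normc (x - c) < e /\ p.[x] = z]); exists x.
  rewrite lt_min => /andP[x1 _] pxi; move: xe; rewrite lt_min => /andP[x2 _].
  have := Hk _ _ x1 x2; rewrite pxi pz subrr Normc.normc0 => h.
  apply/eqP; rewrite -subr_eq0 -normc_eq0 eq_le normc_ge0 andbT.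
  by rewrite -(pmulr_rle0 _ k0).
have xiP z : normc z < r -> normc (xi z - c) < e /\ p.[xi z] = z.
  move=> zr; have [x xe pz] : exists2 x, normc (x - c) < e & p.[x] = z.
    by apply: Hr; rewrite [z - 0]subr0.
  by rewrite (xiE x z).
exists xi; split.
- apply/nbhs_normcP; exists r => // z; rewrite [z - 0]subr0 => zr.
  have [xe px] := xiP _ zr; set x := xi z in xe px *.
  move: (xe); rewrite lt_min => /andP[xd xd1]; have dpx := Hd1 _ xd1.
  have a0 : 0 < normc p^`().[x] by rewrite normc_gt0.
  suff Hd : is_derive z 1 xi (p^`().[x])^-1 by case: Hd.
  apply/is_derive_normcP => eps eps0.
  have Ha := (is_derive_normcP _ _ _).1 (is_derive1_horner p x).
  (* The tangent error of p at x, at most eps k |p'(x)| |y - x|, becomes eps |w| after |y - x| <=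
     |w| / k and division by p'(x). *)
  have f0 : 0 < eps * k * normc p^`().[x] by rewrite !mulr_gt0.
  have [s s0 Hs] := Ha _ f0.
  exists (Num.min (k * s) (r - normc z)); first by rewrite lt_min mulr_gt0 // subr_gt0.
  move=> w; rewrite lt_min => /andP[w1 w2].
  have zwr : normc (z + w) < r by have := ler_normcD z w; lra.
  have [ye py] := xiP _ zwr; set y := xi (z + w) in ye py *.
  move: (ye); rewrite lt_min => /andP[yd _].
  have zw : z + w - z = w by ring.
  have h1 := Hk _ _ yd xd; rewrite px py zw in h1.
  have h2 : normc (y - x) < s by rewrite -(ltr_pM2l k0); apply: le_lt_trans h1 _.
  have := Hs _ h2; rewrite [x + _]addrC subrK px py zw => h3.
  rewrite (_ : y - x - _ = - (w - p^`().[x] * (y - x)) / p^`().[x]); last by field.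
  rewrite Normc.normcM Normc.normcV (normcN (w - _)) ler_pdivrMr //.
  apply: le_trans h3 _.
  have : eps * normc p^`().[x] * (k * normc (y - x)) <= eps * normc p^`().[x] * normc w.
    by rewrite ler_pM2l // mulr_gt0.
  lra.
- by apply: xiE => //; rewrite subrr Normc.normc0.
- near=> x; apply: xiE => //.
  by near: x; apply/nbhs_normcP; exists e.
- apply/nbhs_normcP; exists r => // z; rewrite [z - 0]subr0 => zr.
  by have [] := xiP _ zr.
Unshelve. all: by end_near. Qed.

End LocalAnalysis.

(** * Orders of functions of one variable *)

Section Orders.
Context {R : realType}.
Local Notation C := R[i].
Local Notation normc := (@Normc.normc R).
Implicit Types (f h u v psi : C -> C) (z w c l : C) (p F : {poly C}).

Lemma near_fst (P : set C) (a b : C) : (\forall x \near a, P x) ->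
  \forall q \near (a, b), P q.1.
Proof. by move=> H; exists (P, setT) => /=; [split=> //; exact: filterT | move=> q []]. Qed.

Lemma near_snd (P : set C) (a b : C) : (\forall x \near b, P x) ->
  \forall q \near (a, b), P q.2.
Proof. by move=> H; exists (setT, P) => /=; [split=> //; exact: filterT | move=> q []]. Qed.

Definition laurent_order psi (n : int) := exists u,
  [/\ hol_at u 0, u 0 != 0 & \forall t \near 0, t != 0 -> psi t = t ^ n * u t].

Lemma eq_laurent_order psi psi' n : (\forall t \near 0, t != 0 -> psi t = psi' t) ->
  laurent_order psi n -> laurent_order psi' n.
Proof.
move=> E [u [hu u0 H]]; exists u; split=> //.
by apply: filterS2 E H => t E H t0; rewrite -E // H.
Qed.

Lemma laurent_order_unit u : hol_at u 0 -> u 0 != 0 -> laurent_order u 0.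
Proof.
move=> hu u0; exists u; split=> //; apply: filterE => t _.
by rewrite expr0z mul1r.
Qed.

Lemma laurent_order_id : laurent_order (fun t => t) 1.
Proof.
exists (fun=> 1); split; [exact: hol_at_cst | exact: oner_neq0 |].
by apply: filterE => t _; rewrite mulr1 expr1z.
Qed.

Lemma laurent_orderM psi psi' n n' : laurent_order psi n -> laurent_order psi' n' ->
  laurent_order (fun t => psi t * psi' t) (n + n').
Proof.
move=> [u [hu u0 H]] [u' [hu' u'0 H']]; exists (fun t => u t * u' t).
split; [exact: hol_atM hu hu' | by rewrite mulf_neq0 |].
apply: filterS2 H H' => t H H' t0.
by rewrite H // H' // expfzDr // mulrACA.
Qed.

Lemma laurent_orderV psi n : laurent_order psi n -> laurent_order (fun t => (psi t)^-1) (- n).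
Proof.
move=> [u [hu u0 H]]; exists (fun t => (u t)^-1).
split; [exact: hol_atV hu u0 | by rewrite invr_eq0 |].
by apply: filterS H => t H t0; rewrite H // invfM invr_expz.
Qed.

Lemma laurent_order_expz psi n (k : int) : laurent_order psi n ->
  laurent_order (fun t => psi t ^ k) (n * k).
Proof.
move=> H; have Hn (m : nat) : laurent_order (fun t => psi t ^+ m) (n * m%:Z).
  elim: m => [|m IH].
    rewrite mulr0; under eq_fun do rewrite expr0.
    by apply: laurent_order_unit; [exact: hol_at_cst | exact: oner_neq0].
  under eq_fun do rewrite exprS.
  by rewrite -addn1 PoszD addrC mulrDr mulr1; exact: laurent_orderM.
case: k => m; first exact: Hn.
by rewrite NegzE mulrN; exact: laurent_orderV (Hn m.+1).
Qed.

(** Polynomial inversion covers both cases. If b0 = 0, then t = b and a = xi(t^2) with xi inverse to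
    F. Otherwise t = a - a0, and b is a square root of F(a0 + t) obtained by inverting X^2 - b0^2.
    The density [om] of da/b is 2/F'(a) in the first case and 1/b in the second. *)
Lemma plane_curve_param F (a0 b0 : C) : b0 ^+ 2 = F.[a0] -> (b0 = 0 -> F^`().[a0] != 0) ->
  let tc (q : C * C) := if b0 == 0 then q.2 else q.1 - a0 in
  exists al be om : C -> C,
  [/\ [/\ hol_at al 0, hol_at be 0, al 0 = a0 & be 0 = b0],
      [/\ b0 = 0 -> forall t, be t = t & b0 != 0 -> forall t, al t = a0 + t],
      [/\ \forall t \near 0, be t ^+ 2 = F.[al t],
       \forall t \near 0, tc (al t, be t) = t &
       \forall q \near (a0, b0), q.2 ^+ 2 = F.[q.1] -> q = (al (tc q), be (tc q))] &
      [/\ hol_at om 0, om 0 != 0 &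
          \forall t \near 0, t != 0 -> 'D_1 al t = om t * be t]].
Proof.
move=> HF sm tc; have [b00|b0n] := eqVneq b0 0.
  have Fa0 : F.[a0] = 0 by rewrite -HF b00 expr0n.
  have tcE q : tc q = q.2 by rewrite /tc b00 eqxx.
  have dF := sm b00; have [xi [hxi xi0 xiF Fxi]] := horner_local_inverse Fa0 dF.
  have hsq : hol_at (fun t : C => t ^+ 2) 0 by exact: (hol_atX 2 (hol_at_id 0)).
  have sq0 : (0 : C) ^+ 2 = 0 by rewrite expr0n.
  pose al t := xi (t ^+ 2).
  have hal : hol_at al 0 := @hol_at_comp _ xi _ 0 0 hsq sq0 hxi.
  have al0 : al 0 = a0 by rewrite /al sq0.
  have Fal : \forall t \near 0, F.[al t] = t ^+ 2.
    exact: (near_comp (P := fun z => F.[xi z] = z) (hol_at_continuous hsq) sq0 Fxi).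
  have hFal : hol_at (fun t => F^`().[al t]) 0 :=
    @hol_at_comp _ (horner F^`()) _ 0 _ hal erefl (hol_at_horner F^`() _).
  have Fal0 : F^`().[al 0] != 0 by rewrite al0.
  exists al, (fun t => t), (fun t => 2 * (F^`().[al t])^-1); split.
  - by split; [exact: hal | exact: hol_at_id | exact: al0 | rewrite b00].
  - by split=> //; rewrite b00 eqxx.
  - split.
    + by apply: filterS Fal => t ->.
    + by apply: filterE => t; rewrite tcE.
    + have := near_fst b0 xiF; apply: filterS => -[a b] /= E Fab.
      by rewrite tcE /= /al Fab E.
  - split.
    + exact: (hol_atM (hol_at_cst 2 0) (hol_atV hFal Fal0)).
    + by rewrite mulf_neq0 ?invr_eq0 // pnatr_eq0.
    + have nz := near_neq0 (hol_at_continuous hFal) Fal0.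
      apply: filterS3 (near_join Fal) hal nz => t Ft dal nzt t0.
      (* F(al s) = s^2 is differentiated at t in two ways; [near_join] supplies the identity around
         t, not only at t. *)
      have D1 : is_derive t 1 (fun s => F.[al s]) (F^`().[al t] * 'D_1 al t).
        exact: (@is_derive1_compc _ (horner F) al t _ _ (is_derive1_horner F _) (derivableP dal)).
      have D2 : is_derive t 1 (fun s => F.[al s]) (t * 1 + t * 1).
        have did : is_derive t 1 (fun s : C => s) 1 by exact: is_derive_id.
        have dsq := is_derive1M did did.
        apply: (near_eq_is_derive _ dsq).
        by apply: filterS Ft => s ->; rewrite expr2.
      have : F^`().[al t] * 'D_1 al t = t * 1 + t * 1.
        by rewrite -(@derive_val _ _ _ _ _ _ _ D1) (@derive_val _ _ _ _ _ _ _ D2).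
      move=> E; apply: (mulfI nzt); rewrite E; field; exact: nzt.
have tcE q : tc q = q.1 - a0 by rewrite /tc (negPf b0n).
pose p : {poly C} := 'X^2 - (b0 ^+ 2)%:P.
have pb b : p.[b] = b ^+ 2 - b0 ^+ 2 by rewrite !hornerE.
have [||eta [heta eta0 etap peta]] := @horner_local_inverse _ p b0.
- by rewrite pb subrr.
- rewrite derivB derivXn derivC subr0 hornerMn hornerXn expr1.
  by rewrite mulrn_eq0 /= b0n.
pose k t := F.[a0 + t] - F.[a0].
have hal : hol_at (fun t : C => a0 + t) 0.
  exact: (hol_atD (hol_at_cst a0 0) (hol_at_id 0)).
have hk : hol_at k 0 := hol_atB (@hol_at_comp _ (horner F) _ 0 _ hal erefl (hol_at_horner F _))
  (hol_at_cst F.[a0] 0).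
have k0 : k 0 = 0 by rewrite /k addr0 subrr.
pose be t := eta (k t).
have hbe : hol_at be 0 := @hol_at_comp _ eta _ 0 0 hk k0 heta.
have be0 : be 0 = b0 by rewrite /be k0.
have be0n : be 0 != 0 by rewrite be0.
exists (fun t => a0 + t), be, (fun t => (be t)^-1); split.
- by split; [exact: hal | exact: hbe | rewrite addr0 | exact: be0].
- by split=> // b00; rewrite b00 eqxx in b0n.
- split.
  + have : \forall t \near 0, p.[eta (k t)] = k t.
      exact: (near_comp (P := fun z => p.[eta z] = z) (hol_at_continuous hk) k0 peta).
    apply: filterS => t H0; have := pb (eta (k t)); rewrite H0 /k -HF => /addIr H1.
    by rewrite [RHS]H1 /be /k -HF.
  + by apply: filterE => t; rewrite tcE /=; ring.
  + have := near_snd a0 etap; apply: filterS => -[a b] /= E Fab.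
    have aE : a0 + (a - a0) = a by ring.
    by rewrite tcE /= /be /k aE -Fab -HF -pb E.
- split; [exact: hol_atV hbe be0n | by rewrite invr_eq0 |].
  apply: filterS (near_neq0 (hol_at_continuous hbe) be0n) => t bt _.
  have D1 : is_derive t 1 (fun s : C => a0 + s) (0 + 1).
    exact: is_deriveD.
  by rewrite mulVf // (@derive_val _ _ _ _ _ _ _ D1) add0r.
Qed.

End Orders.

(** * Local parameters of the curve *)

Section Curve.
Context {R : realType} (g N : nat) (e : 'I_N -> R[i]).
Hypothesis he : injective e.
Hypothesis hN : N = (2 * g + 2)%N \/ N = (2 * g + 1)%N.
Local Notation C := R[i].
Local Notation X := (hyperelliptic g e).
Implicit Types (P Q : X) (h : X -> C).

Definition affine_poly : {poly C} := \prod_(i < N) ('X - (e i)%:P).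
Definition infinity_cofactor : {poly C} := \prod_(i < N) (1 - e i *: 'X).
Definition infinity_poly : {poly C} := 'X^(2 * g + 2 - N) * infinity_cofactor.

Lemma horner_affine_poly x : affine_poly.[x] = affine_rhs e x.
Proof. by rewrite horner_prod; apply: eq_bigr => i _; rewrite !hornerE. Qed.

Lemma horner_infinity_cofactor w : infinity_cofactor.[w] = \prod_(i < N) (1 - w * e i).
Proof. by rewrite horner_prod; apply: eq_bigr => i _; rewrite !hornerE mulrC. Qed.

Lemma infinity_cofactor0 : infinity_cofactor.[0] = 1.
Proof.
by rewrite horner_infinity_cofactor big1 // => i _; rewrite mul0r subr0.
Qed.

Lemma horner_infinity_poly w : infinity_poly.[w] = infinity_rhs g e w.
Proof. by rewrite hornerM hornerXn horner_infinity_cofactor. Qed.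

Lemma infinity_rhsV x : x != 0 -> infinity_rhs g e x^-1 = affine_rhs e x / x ^+ (2 * g + 2).
Proof.
move=> x0; rewrite /infinity_rhs /affine_rhs.
have NE : (2 * g + 2 = (2 * g + 2 - N) + N)%N by lia.
rewrite [in RHS]NE exprD invfM mulrCA exprVn; congr (_ * _).
have -> : x ^- N = \prod_(i < N) x^-1 by rewrite prodr_const card_ord exprVn.
rewrite -big_split; apply: eq_bigr => i _ /=.
by rewrite mulrBl mulfV // [e i * _]mulrC.
Qed.

Definition curve_poly P := match P with inl _ => affine_poly | inr _ => infinity_poly end.

Lemma chart_curve P Q q : chart P Q = Some q -> q.2 ^+ 2 = (curve_poly P).[q.1].
Proof.
case: P Q => [p|p] [[[x y] /= hxy]|[v /= hv]] //=.
- by move=> [<-] /=; rewrite horner_affine_poly; apply/eqP.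
- have [//|x0] := eqVneq x 0; move=> [<-] /=.
  rewrite horner_infinity_poly infinity_rhsV // expr_div_n (eqP hxy) -exprM.
  by congr (_ / x ^+ _); lia.
- by move=> [<-] /=; rewrite horner_infinity_poly; apply/eqP.
Qed.

Lemma chart_surj P q : q.2 ^+ 2 = (curve_poly P).[q.1] -> exists Q, chart P Q = Some q.
Proof.
case: q => a b; case: P => [p|p] /=.
  rewrite horner_affine_poly => /eqP H.
  by exists (inl (Sub (a, b) H)).
rewrite horner_infinity_poly; have [->|a0] := eqVneq a 0.
  by move=> /eqP H; exists (inr (Sub b H)).
move=> H; have H' : (b * a^-1 ^+ g.+1) ^+ 2 == affine_rhs e a^-1.
  have := @infinity_rhsV a^-1; rewrite invr_eq0 invrK -H => /(_ a0) Hb.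
  rewrite exprMn Hb -mulrA -exprM (_ : (2 * g + 2)%N = (g.+1 * 2)%N); last by lia.
  by rewrite mulVf ?mulr1 // expf_neq0 // invr_eq0.
exists (inl (Sub (a^-1, b * a^-1 ^+ g.+1) H')) => /=.
by rewrite invr_eq0 (negPf a0) invrK mulfK // expf_neq0 // invr_eq0.
Qed.

Lemma chart_inj P Q Q' q : chart P Q = Some q -> chart P Q' = Some q -> Q = Q'.
Proof.
case: P Q Q' => [p|p] [r|v] [r'|v'] //=.
- by move=> [<-] [E]; congr inl; exact/val_inj.
- case: ifPn => // r0; case: ifPn => // r'0 [<-] [/invr_inj E1].
  rewrite E1 => E2; congr inl; apply: val_inj.
  rewrite [LHS]surjective_pairing [RHS]surjective_pairing; congr (_, _); first exact: esym E1.
  by apply/esym; apply: mulIf E2; rewrite invr_eq0 expf_neq0.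
- case: ifPn => // r0 <- /(congr1 (fun o => (odflt (0, 0) o).1)) /= /esym/eqP.
  by rewrite invr_eq0 (negPf r0).
- case: ifPn => // r0 <- /(congr1 (fun o => (odflt (0, 0) o).1)) /= /eqP.
  by rewrite invr_eq0 (negPf r0).
- by move=> [<-] [E]; congr inr; exact: val_inj.
Qed.

Lemma affine_rhs_eq0 x : affine_rhs e x = 0 -> exists i, x = e i.
Proof.
by move=> /eqP/prodf_eq0[i _]; rewrite subr_eq0 => /eqP ->; exists i.
Qed.

Lemma affine_rhs_branch i : affine_rhs e (e i) = 0.
Proof. by rewrite /affine_rhs (bigD1 i) //= subrr mul0r. Qed.

Lemma affine_poly_branch i :
  affine_poly = ('X - (e i)%:P) * \prod_(j < N | j != i) ('X - (e j)%:P).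
Proof. by rewrite /affine_poly (bigD1 i). Qed.

Lemma affine_cofactor_neq0 i : (\prod_(j < N | j != i) ('X - (e j)%:P)).[e i] != 0.
Proof.
rewrite horner_prod; apply/prodf_neq0 => j ji.
by rewrite !hornerE subr_eq0 (inj_eq he) eq_sym.
Qed.

Lemma N_odd : N != (2 * g + 2)%N -> N = (2 * g + 1)%N.
Proof. by case: hN => ->; rewrite ?eqxx. Qed.

(** Distinctness of the [e i] makes affine zeros simple. Over infinity the exponent 2g + 2 - N is 0,
    and then b is not 0, or 1, and then w is a simple factor. *)
Lemma chart_smooth P q : chart P P = Some q -> q.2 = 0 -> (curve_poly P)^`().[q.1] != 0.
Proof.
move=> cP q20; have := chart_curve cP; rewrite q20 expr0n /= => /esym H.
case: P cP H => [p|p] /= [qE] H.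
  have [i qi] : exists i, q.1 = e i by apply: affine_rhs_eq0; rewrite -horner_affine_poly.
  rewrite qi (affine_poly_branch i) derivM derivXsubC !hornerE subrr mul0r addr0.
  exact: affine_cofactor_neq0.
have q1 : q.1 = 0 by rewrite -qE.
move: H; rewrite q1 /infinity_poly.
have [NE|/N_odd NE] := eqVneq N (2 * g + 2)%N.
  by rewrite {1}NE subnn expr0 mul1r infinity_cofactor0 => /eqP; rewrite oner_eq0.
have -> : (2 * g + 2 - N = 1)%N by lia.
by move=> _; rewrite derivM derivXn expr0 !hornerE infinity_cofactor0 oner_neq0.
Qed.

(* [phi t] is the point of local coordinate t around P, (al, be) are its
   coordinates (a, b) in the chart, and da / b = om(t) dt. *)
Record local_param P (phi : C -> X) (al be om : C -> C) : Prop := LocalParam {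
  lp_near : forall A, near_point P A -> \forall t \near 0, A (phi t);
  lp_point : forall B : set C, (\forall t \near 0, B t) ->
    near_point P (fun Q => Q = phi (local_coord P Q) /\ B (local_coord P Q));
  lp_chart : \forall t \near 0, chart P (phi t) = Some (al t, be t);
  lp_coord : \forall t \near 0, local_coord P (phi t) = t;
  lp_center : chart P P = Some (al 0, be 0);
  lp_al : hol_at al 0;
  lp_be : hol_at be 0;
  lp_om : hol_at om 0;
  lp_om0 : om 0 != 0;
  lp_curve : \forall t \near 0, be t ^+ 2 = (curve_poly P).[al t];
  lp_branch : be 0 = 0 -> forall t, be t = t;
  lp_generic : be 0 != 0 -> forall t, al t = al 0 + t;
  lp_derive : \forall t \near 0, t != 0 -> 'D_1 al t = om t * be t
}.

Lemma chart_self P : exists q, chart P P = Some q.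
Proof. by case: P => [p|p]; eexists. Qed.

Lemma local_paramP P : exists phi al be om, local_param P phi al be om.
Proof.
have [[a0 b0] cP] := chart_self P.
have [al [be [om]]] := plane_curve_param (chart_curve cP) (chart_smooth cP).
move=> [[hal hbe al0 be0] [br gen] [cur tc pt] [hom om0 der]].
rewrite /= in al0 be0 br gen cur tc pt.
(* By [chart_surj] such a point exists whenever (al t, be t) lies on the curve, hence for t near 0;
   the default [P] is met only elsewhere. *)
pose phi t := xget P [set Q | chart P Q = Some (al t, be t)].
have cphi t : be t ^+ 2 = (curve_poly P).[al t] -> chart P (phi t) = Some (al t, be t).
  move=> H; have [Q HQ] := @chart_surj P (al t, be t) H.
  exact: (@xgetPex _ P [set Q | chart P Q = Some (al t, be t)] (ex_intro _ Q HQ)).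
have ch : \forall t \near 0, chart P (phi t) = Some (al t, be t).
  by apply: filterS cur => t; exact: cphi.
have lcE Q q : chart P Q = Some q -> local_coord P Q = if b0 == 0 then q.2 else q.1 - a0.
  by rewrite /local_coord cP => ->; case: q.
exists phi, al, be, om; constructor.
- move=> A; rewrite /near_point cP.
  have cvq : (al t, be t) @[t --> 0] --> (a0, b0).
    rewrite -al0 -be0.
    exact: (cvg_pair (hol_at_continuous hal) (hol_at_continuous hbe)).
  move=> nA; have nA' : \forall t \near 0,
    forall Q, chart P Q = Some (al t, be t) -> A Q := cvq _ nA.
  by apply: filterS2 nA' ch => t H1 H2; exact: H1 _ H2.
- move=> B nB; rewrite /near_point cP.
  have nBt : \forall q \near (a0, b0), B (if b0 == 0 then q.2 else q.1 - a0).
    have [b00|_] := eqVneq b0 0; first by apply: near_snd; rewrite b00.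
    have hs : hol_at (fun a : C => a - a0) a0.
      exact: (hol_atB (hol_at_id a0) (hol_at_cst a0 a0)).
    have := near_comp (hol_at_continuous hs) (subrr a0) nB.
    exact: near_fst.
  apply: filterS2 pt nBt => q Hq HB Q cQ.
  rewrite (lcE _ _ cQ); split => //; apply: (chart_inj cQ).
  have qs s : q = (al s, be s) -> chart P (phi s) = Some q.
    by move=> qE; rewrite qE; apply: cphi; have := chart_curve cQ; rewrite qE.
  exact: qs (Hq (chart_curve cQ)).
- exact: ch.
- by apply: filterS2 ch tc => t /lcE ->.
- by rewrite cP al0 be0.
- exact: hal.
- exact: hbe.
- exact: hom.
- exact: om0.
- exact: cur.
- by rewrite be0.
- by rewrite be0 al0.
- exact: der.
Qed.

End Curve.

(** * Divisors of x, y and dx *)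

Section Principal.
Context {R : realType} (g N : nat) (e : 'I_N -> R[i]).
Hypothesis he : injective e.
Hypothesis hN : N = (2 * g + 2)%N \/ N = (2 * g + 1)%N.
Local Notation C := R[i].
Local Notation X := (hyperelliptic g e).
Implicit Types (P Q : X) (h : X -> C).

Lemma laurent_order_neq0 (psi : C -> C) n : laurent_order psi n ->
  \forall t \near 0, t != 0 -> psi t != 0.
Proof.
move=> [u [hu u0 H]]; have un := near_neq0 (hol_at_continuous hu) u0.
by apply: filterS2 H un => t H un t0; rewrite H // mulf_neq0 // expfz_neq0.
Qed.

Lemma local_coord_center P : local_coord P P = 0.
Proof.
by rewrite /local_coord; case: (chart P P) => // -[a b]; case: eqP => [->|]; rewrite ?subrr.
Qed.

Lemma local_param_center P phi al be om : local_param P phi al be om -> phi 0 = P.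
Proof.
by move=> lp; apply: (chart_inj (nbhs_singleton (lp_chart lp))); rewrite (lp_center lp).
Qed.

(** Every question about orders on the surface becomes one about a function of one variable near
    0. *)
Lemma has_orderE h P phi al be om n : local_param P phi al be om ->
  has_order h P n <-> laurent_order (h \o phi) n.
Proof.
move=> lp; split=> -[u [hu u0 H]]; exists u; split=> //.
  apply: filterS2 (lp_near lp H) (lp_coord lp) => t H1 H2 t0.
  have phiP : phi t != P.
    by apply: contra t0 => /eqP E; rewrite -H2 E local_coord_center.
  by have := H1 phiP; rewrite H2.
have := lp_point lp H; rewrite /near_point; case: (chart P P) => // q0.
apply: filterS => q Hq Q /Hq[E HQ] QP; have Q0 : local_coord P Q != 0.
  by apply: contra QP => /eqP E0; rewrite E E0 (local_param_center lp).
by rewrite -HQ // /= -E.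
Qed.

(** The value 0 over infinity is a placeholder: close to a point over infinity all other points are
    affine. *)
Definition xcoord Q : C := if Q is inl q then (val q).1 else 0.
Definition ycoord Q : C := if Q is inl q then (val q).2 else 0.

(** The ramification index of x over infinity, which is the order of w = 1/x there. *)
Definition ramif : int := if N == (2 * g + 2)%N then 1 else 2.

(* The polar divisor of x, a representative of the class D. *)
Definition infinity_div P : int := if P is inl _ then 0 else ramif.

(** For even N the local coordinate is w itself. For odd N it is v, and v^2 = w G(w) with G(0) = 1
    gives w = t^2 / G(w). *)
Lemma infinity_param_al (v : infinite_point g e) phi al be om :
  local_param (inr v : X) phi al be om -> al 0 = 0 /\ laurent_order al ramif.
Proof.
move=> lp; have [a0 b0] : Some (0, val v) = Some (al 0, be 0) := lp_center lp.
split; first by rewrite -a0.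
rewrite /ramif; have vE := chart_curve hN (lp_center lp).
rewrite /= -a0 /infinity_poly in vE.
have [NE|Nn] := eqVneq N (2 * g + 2)%N.
  have be0 : be 0 != 0.
    apply/eqP => be0; move: vE; rewrite be0 {1}NE subnn expr0n /= expr0 mul1r.
    by rewrite infinity_cofactor0 => /esym/eqP; rewrite oner_eq0.
  apply: eq_laurent_order laurent_order_id; apply: filterE => t _.
  by rewrite (lp_generic lp be0) -a0 add0r.
have NE := N_odd hN Nn; have k1 : (2 * g + 2 - N = 1)%N by lia.
have be0 : be 0 = 0.
  by apply/eqP; rewrite -sqrf_eq0 vE k1 expr1 hornerM hornerX mul0r.
pose G := infinity_cofactor e.
have hG : hol_at (fun t => G.[al t]) 0 :=
  @hol_at_comp _ (horner G) _ 0 _ (lp_al lp) erefl (hol_at_horner G _).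
have G0 : G.[al 0] != 0 by rewrite -a0 infinity_cofactor0 oner_neq0.
exists (fun t => (G.[al t])^-1); split; [exact: hol_atV hG G0| by rewrite invr_eq0|].
apply: filterS2 (lp_curve lp) (near_neq0 (hol_at_continuous hG) G0) => t ct Gt t0.
apply: (mulIf Gt); rewrite mulfVK //.
by rewrite (lp_branch lp be0) /= /infinity_poly k1 expr1 hornerM hornerX in ct; rewrite -ct.
Qed.

Lemma local_param_coords P phi al be om : local_param P phi al be om ->
  \forall t \near 0, t != 0 ->
    (exists q, phi t = inl q) /\
    match P with
    | inl _ => xcoord (phi t) = al t /\ ycoord (phi t) = be t
    | inr _ => [/\ al t != 0, xcoord (phi t) = (al t)^-1 &
                   ycoord (phi t) = be t * al t ^ (- (g.+1)%:Z)]
    end.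
Proof.
case: P => [p|v] lp.
  apply: filterS (lp_chart lp) => t; case: (phi t) => [q|//] /= [E] _.
  by split; [exists q | rewrite E].
have [al0 oal] := infinity_param_al lp.
apply: filterS2 (lp_chart lp) (laurent_order_neq0 oal) => t ct alt t0.
have an := alt t0; case: (phi t) ct => [q|w] /=; last first.
  by move=> /(congr1 (fun o => (odflt (0, 0) o).1)) /= E; rewrite -E eqxx in an.
case: ifPn => // q0 E; split; first by exists q.
have E1 := congr1 (fun o => (odflt (0, 0) o).1) E.
have E2 := congr1 (fun o => (odflt (0, 0) o).2) E.
rewrite /= in E1 E2; split=> //; first by rewrite -E1 invrK.
by rewrite -E1 -E2 -exprnN exprVn invrK mulfVK // expf_neq0.
Qed.

Lemma branch_eq i : (0 : C) ^+ 2 == affine_rhs e (e i).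
Proof. by rewrite affine_rhs_branch expr0n. Qed.

Definition branch_point i : X := inl (Sub (e i, 0) (branch_eq i)).

Lemma has_order_x i P : has_order (fun Q => xcoord Q - e i) P
  ((P == branch_point i)%:Z *+ 2 - infinity_div P).
Proof.
have [phi [al [be [om lp]]]] := local_paramP he hN P.
apply/(has_orderE _ _ lp).
case: P lp => [p|v] lp; last first.
  have [al0 oal] := infinity_param_al lp.
  have ho : laurent_order (fun t => 1 - e i * al t) 0.
    apply: laurent_order_unit; last by rewrite al0 mulr0 subr0 oner_neq0.
    exact: (hol_atB (hol_at_cst 1 0) (hol_atM (hol_at_cst (e i) 0) (lp_al lp))).
  rewrite /= mul0rn sub0r -[- ramif]addr0.
  apply: eq_laurent_order (laurent_orderM (laurent_orderV oal) ho).
  apply: filterS (local_param_coords lp) => t H t0 /=; have [_ [a0 -> _]] := H t0.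
  by field.
rewrite /= subr0.
have cen : val p = (al 0, be 0) by have [] := lp_center lp.
have hai : hol_at (fun t => al t - e i) 0 := hol_atB (lp_al lp) (hol_at_cst (e i) 0).
have pc : (val p).2 ^+ 2 = affine_rhs e (val p).1 by apply/eqP; exact: (valP p).
case: eqP => [[pE]|pn].
  move: cen; rewrite pE /= => -[ai0 be0].
  pose G : {poly C} := \prod_(j < N | j != i) ('X - (e j)%:P).
  have hG : hol_at (fun t => G.[al t]) 0 :=
    @hol_at_comp _ (horner G) _ 0 _ (lp_al lp) erefl (hol_at_horner G _).
  have G0 : G.[al 0] != 0 by rewrite -ai0; exact: affine_cofactor_neq0.
  exists (fun t => (G.[al t])^-1); split; [exact: hol_atV hG G0| by rewrite invr_eq0|].
  apply: filterS3 (lp_curve lp) (near_neq0 (hol_at_continuous hG) G0)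
    (local_param_coords lp) => t ct Gt cd t0 /=.
  have [_ [-> _]] := cd t0.
  apply: (mulIf Gt); rewrite mulfVK //.
  rewrite /= (lp_branch lp (esym be0)) (affine_poly_branch e i) hornerM !hornerE in ct.
  by rewrite -/G in ct; rewrite -ct.
rewrite mul0rn.
apply: (@eq_laurent_order _ (fun t => al t - e i)).
  by apply: filterS (local_param_coords lp) => t cd t0 /=; have [_ [-> _]] := cd t0.
apply: laurent_order_unit; first exact: hai.
rewrite subr_eq0; apply/eqP => ai; apply: pn; congr inl; apply: val_inj => /=.
rewrite cen ai; congr (_, _); apply/eqP.
by rewrite -sqrf_eq0 -[be 0]/((al 0, be 0).2) -cen pc cen /= ai affine_rhs_branch.
Qed.

(** In either chart the second coordinate has order 1 at a branch point and 0 elsewhere; over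
    infinity y = v w^-(g+1). *)
Lemma has_order_y P : has_order ycoord P
  ((P \in branch_set g e)%:Z - infinity_div P * g.+1%:Z).
Proof.
have [phi [al [be [om lp]]]] := local_paramP he hN P.
apply/(has_orderE _ _ lp).
have ordb : laurent_order be (be 0 == 0)%:Z.
  case: eqP => [b0|/eqP b0]; last exact: laurent_order_unit (lp_be lp) b0.
  apply: eq_laurent_order laurent_order_id; apply: filterE => t _.
  by rewrite (lp_branch lp b0).
case: P lp => [p|v] lp; last first.
  have [al0 oal] := infinity_param_al lp.
  have bE : be 0 = val v by have [_ E] := lp_center lp; rewrite -E.
  have -> : (inr v : X) \in branch_set g e = (be 0 == 0).
    have vE := chart_curve hN (lp_center lp); rewrite /= al0 /infinity_poly in vE.
    apply/idP/idP => [/set_mem/= NE|/eqP be0].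
      have k1 : (2 * g + 2 - N = 1)%N by lia.
      by rewrite -sqrf_eq0 vE k1 expr1 hornerM hornerX mul0r.
    apply/mem_set => /=; apply: (N_odd hN); apply/eqP => NE.
    move: vE; rewrite be0 {1}NE subnn expr0n /= expr0 mul1r.
    by rewrite infinity_cofactor0 => /esym/eqP; rewrite oner_eq0.
  have := laurent_orderM ordb (laurent_order_expz (- (g.+1)%:Z) oal).
  rewrite mulrN; apply: eq_laurent_order.
  by apply: filterS (local_param_coords lp) => t cd t0 /=; have [_ [_ _ ->]] := cd t0.
have cen : val p = (al 0, be 0) by have [] := lp_center lp.
have -> : (inl p : X) \in branch_set g e = (be 0 == 0).
  have pc : (val p).2 ^+ 2 = affine_rhs e (val p).1 by apply/eqP; exact: (valP p).
  apply/idP/idP => [/set_mem bp|/eqP be0].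
    by have [ i] := bp; rewrite cen => -[_ ->].
  apply/mem_set => /=; have [i ai] : exists i, al 0 = e i.
    apply: affine_rhs_eq0; have := pc; rewrite cen /= be0 => <-.
    by rewrite expr0n.
  by exists i; rewrite cen ai be0.
rewrite /= mul0r subr0; apply: eq_laurent_order ordb.
by apply: filterS (local_param_coords lp) => t cd t0 /=; have [_ [_ ->]] := cd t0.
Qed.

(** h y is the quotient of h dx by dx/y. In the affine chart dx/y = om dt; over infinity dx = - dw /
    w^2 and y = v w^-(g+1), so dx/y = - w^(g-1) om dt, which explains the shift by (g - 1) times the
    order of w. *)
Lemma has_form_order_y h P n : has_form_order h P n ->
  has_order (fun Q => h Q * ycoord Q) P (n - infinity_div P * (g%:Z - 1)).
Proof.
move=> [u [xi [hu u0 H]]].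
have [phi [al [be [om lp]]]] := local_paramP he hN P.
apply/(has_orderE _ _ lp).
have Hphi : \forall t \near 0, t != 0 ->
    [/\ xcoord (phi t) = xi t, derivable xi t 1 & h (phi t) * 'D_1 xi t = t ^ n * u t].
  apply: filterS3 (lp_near lp H) (lp_coord lp) (local_param_coords lp) => t H1 H2 H3 t0.
  have [[q qE] _] := H3 t0.
  have phiP : phi t != P.
    by apply: contra t0 => /eqP E; rewrite -H2 E local_coord_center.
  by have := H1 phiP; rewrite /= H2 /xcoord; move: qE; case: (phi t).
have omn := near_neq0 (hol_at_continuous (lp_om lp)) (lp_om0 lp).
have nbhs_neq (t : C) : t != 0 -> \forall s \near t, s != 0.
  move=> t0; apply/nbhs_normcP; exists (Normc.normc t); first by rewrite normc_gt0.
  by move=> s; apply: contraTneq => ->; rewrite -leNgt normc_dist subr0.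
case: P lp H => [p|v] lp H.
  rewrite /= mul0r subr0.
  exists (fun t => u t * (om t)^-1); split.
  - exact: (hol_atM hu (hol_atV (lp_om lp) (lp_om0 lp))).
  - by rewrite mulf_neq0 ?invr_eq0 // (lp_om0 lp).
  (* Agreement off 0 suffices: derivatives are compared at t != 0, around which it holds on a full
     neighbourhood. *)
  have xa : \forall t \near 0, t != 0 -> xi t = al t.
    apply: filterS2 Hphi (local_param_coords lp) => t h1 h2 t0.
    by have [<- _ _] := h1 t0; have [_ [->]] := h2 t0.
  have nA := @filterI _ _ (nbhs_filter (0 : C)) _ _ Hphi (near_join xa); have nB := @filterI _ _ (nbhs_filter (0 : C)) _ _ omn (lp_derive lp).
  apply: filterS3 nA (local_param_coords lp) nB => t [h1 h2] h3 [omt h4] t0 /=.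
  have [_ dxi E] := h1 t0; have [_ [_ ->]] := h3 t0.
  have Dx : 'D_1 xi t = om t * be t.
    rewrite -(h4 t0); apply: near_eq_derive.
    by apply: filterS2 h2 (nbhs_neq _ t0) => s; apply.
  by apply: (mulIf omt); rewrite -mulrA [_ * om t]mulrC -Dx E mulrA mulfVK.
have [al0 oal] := infinity_param_al lp.
have hfac : laurent_order (fun t => - (u t * (om t)^-1)) 0.
  apply: laurent_order_unit; last first.
    by rewrite oppr_eq0 mulf_neq0 ?invr_eq0 // (lp_om0 lp).
  exact: (hol_atN (hol_atM hu (hol_atV (lp_om lp) (lp_om0 lp)))).
have ordn := laurent_order_expz n (@laurent_order_id R).
have := laurent_orderM (laurent_orderM ordn hfac) (laurent_order_expz (1 - g%:Z) oal).
rewrite mul1r addr0 -[1 - g%:Z]opprB mulrN; apply: eq_laurent_order.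
have xa : \forall t \near 0, t != 0 -> al t * xi t = 1.
  apply: filterS2 Hphi (local_param_coords lp) => t h1 h2 t0.
  by have [<- _ _] := h1 t0; have [_ [a0 -> _]] := h2 t0; rewrite mulfV.
have nA := @filterI _ _ (nbhs_filter (0 : C)) _ _ Hphi (near_join xa); have nB := @filterI _ _ (nbhs_filter (0 : C)) _ _ omn (lp_derive lp).
have nC := @filterI _ _ (nbhs_filter (0 : C)) _ _ (local_param_coords lp) (lp_al lp).
apply: filterS3 nA nC nB => t [h1 h2] [h3 dal] [omt h4] t0 /=.
have [_ dxi E] := h1 t0; have [_ [an _ ->]] := h3 t0.
have xt : xi t = (al t)^-1.
  apply: (mulfI an); rewrite mulfV //; exact: (nbhs_singleton h2 t0).
(* This is the derivative of al * xi = 1, that is of w x = 1. *)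
have Dx : al t * 'D_1 xi t + xi t * (om t * be t) = 0.
  rewrite -(h4 t0).
  have D1 := is_derive1M (derivableP dal) (derivableP dxi).
  have N1 : \forall s \near t, 1 = al s * xi s.
    by apply: filterS2 h2 (nbhs_neq _ t0) => s H1 H2; rewrite H1.
  have c1 : is_derive t 1 (fun _ : C => 1 : C) 0 by exact: is_derive_cst.
  have D2 := near_eq_is_derive N1 c1.
  by rewrite -(@derive_val _ _ _ _ _ _ _ D1) (@derive_val _ _ _ _ _ _ _ D2).
have Dx' : om t * be t = - (al t ^+ 2 * 'D_1 xi t).
  apply/eqP; rewrite -addr_eq0; apply/eqP.
  have : al t * (al t * 'D_1 xi t + xi t * (om t * be t)) = 0 by rewrite Dx mulr0.
  by rewrite xt => <-; field.
have ez : al t ^ (1 - g%:Z) = al t ^+ 2 * al t ^ (- (g.+1)%:Z).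
  rewrite -[al t ^+ 2]/(al t ^ 2%:Z) -expfzDr //; congr (_ ^ _).
  by rewrite -[g.+1]addn1 PoszD; ring.
rewrite opprB ez.
apply: (mulIf omt); set A := al t ^ (- _); set H0 := h (phi t).
have -> : H0 * (be t * A) * om t = H0 * (om t * be t) * A by ring.
have -> : H0 * (om t * be t) * A = - (H0 * 'D_1 xi t) * al t ^+ 2 * A.
  by rewrite Dx'; ring.
by rewrite E; field; exact: omt.
Qed.

End Principal.

(** * The hyperelliptic involution *)

Section Conjugation.
Context {R : realType} (g N : nat) (e : 'I_N -> R[i]).
Hypothesis he : injective e.
Hypothesis hN : N = (2 * g + 2)%N \/ N = (2 * g + 1)%N.
Local Notation C := R[i].
Local Notation X := (hyperelliptic g e).
Local Notation normc := (@Normc.normc R).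
Implicit Types (P Q : X) (h : X -> C).

(** The bounds on a and on b are kept apart because the lemma will be applied to points whose b is a
    root function of a without known continuity. *)
Lemma has_order_near h P n (a0 b0 : C) : chart P P = Some (a0, b0) -> has_order h P n ->
  exists u, [/\ hol_at u 0, u 0 != 0 & exists2 d : R, 0 < d & forall Q a b,
    chart P Q = Some (a, b) -> a != a0 -> normc (a - a0) < d -> normc (b - b0) < d ->
    let t := if b0 == 0 then b else a - a0 in h Q = t ^ n * u t].
Proof.
move=> cP [u [hu u0 H]]; exists u; split=> //.
move: H; rewrite /near_point cP => -[[A B] /= [/nbhs_normcP[d1 d10 H1] /nbhs_normcP[d2 d20 H2]] HAB].
exists (Num.min d1 d2); first by rewrite lt_min d10.
move=> Q a b cQ aa0; rewrite !lt_min => /andP[/H1 ha _] /andP[_ /H2 hb].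
have QP : Q != P by apply: contra aa0 => /eqP E; move: cQ; rewrite E cP => -[->].
have := HAB (a, b) (conj ha hb) Q cQ QP.
by rewrite /local_coord cP cQ.
Qed.

Section Pair.
Variables (Qp Qm : C -> X) (b : C -> C) (a0 b0 : C).

(** Since (b - b0)(b + b0) = F(a) - F(a0) is small, one factor is small, so the two points over a
    are close to P and P' in one of the two orders. Which one may change with a, as [b] is an
    arbitrary root function; hence the disjunction, which a symmetric expression does not see. *)
Lemma pair_generic h P P' : chart P P = Some (a0, b0) -> chart P' P' = Some (a0, - b0) ->
  b0 != 0 ->
  (forall a, a != a0 -> [/\ chart P (Qp a) = Some (a, b a), chart P (Qm a) = Some (a, - b a),
     chart P' (Qp a) = Some (a, b a) & chart P' (Qm a) = Some (a, - b a)]) ->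
  has_order h P 0 -> has_order h P' 0 ->
  exists u1 u2 : C -> C, [/\ hol_at u1 0, hol_at u2 0, u1 0 != 0, u2 0 != 0 &
   exists2 d : R, 0 < d & forall a, a != a0 -> normc (a - a0) < d ->
     (h (Qp a) = u1 (a - a0) /\ h (Qm a) = u2 (a - a0)) \/
     (h (Qp a) = u2 (a - a0) /\ h (Qm a) = u1 (a - a0))].
Proof.
move=> cP cP' b00 cQ oP oP'.
have [u1 [hu1 u10 [d1 d10 H1]]] := has_order_near cP oP.
have [u2 [hu2 u20 [d2 d20 H2]]] := has_order_near cP' oP'.
exists u1, u2; split=> //.
pose m := Num.min d1 d2; have m0 : 0 < m by rewrite lt_min d10.
have mm0 : 0 < m * m by rewrite mulr_gt0.
have cF := hol_at_continuous (hol_at_horner (curve_poly P) a0).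
have /cvg_normcP/(_ _ mm0)[d3 d30 H3] := cF.
exists (Num.min m d3); first by rewrite lt_min m0.
move=> a aa0; rewrite lt_min => /andP[am ad3].
have [c1 c2 c3 c4] := cQ a aa0.
have key : normc (b a - b0) * normc (b a + b0) < m * m.
  rewrite -Normc.normcM (_ : _ * _ = b a ^+ 2 - b0 ^+ 2); last by ring.
  have E1 := chart_curve hN c1; have E2 := chart_curve hN cP; rewrite /= in E1 E2.
  by rewrite E1 E2; exact: H3 _ ad3.
move: am; rewrite lt_min => /andP[ad1 ad2].
have m1 : m <= d1 by rewrite ge_min lexx.
have m2 : m <= d2 by rewrite ge_min lexx orbT.
have use1 Q y : chart P Q = Some (a, y) -> normc (y - b0) < m -> h Q = u1 (a - a0).
  move=> cQa /lt_le_trans/(_ m1) yb; have := H1 _ _ _ cQa aa0 ad1 yb.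
  by rewrite /= (negPf b00) expr0z mul1r.
have use2 Q y : chart P' Q = Some (a, y) -> normc (y + b0) < m -> h Q = u2 (a - a0).
  move=> cQa /lt_le_trans/(_ m2) yb; have := H2 _ _ _ cQa aa0 ad2.
  by rewrite opprK => /(_ yb); rewrite /= oppr_eq0 (negPf b00) expr0z mul1r.
have [lt|ge] := ltP (normc (b a - b0)) m.
  left; split; first exact: use1 c1 lt.
  by apply: use2 c4 _; rewrite addrC normc_dist.
right; have lt : normc (b a + b0) < m.
  rewrite ltNge; apply/negP => ge2; move: key; apply/negP; rewrite -leNgt.
  by apply: ler_pM => //; exact: ltW.
split; first exact: use2 c3 lt.
apply: use1 c2 _; rewrite (_ : - b a - b0 = - (b a + b0)); last by ring.
by rewrite (normcN (b a + b0)).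
Qed.

(** At a branch point the local coordinate is b, so the conjugate points over a have coordinates
    b(a) and -b(a), and b(a) tends to 0 because its square is F(a). *)
Lemma pair_branch h P n : chart P P = Some (a0, 0) ->
  (forall a, a != a0 -> chart P (Qp a) = Some (a, b a) /\ chart P (Qm a) = Some (a, - b a)) ->
  has_order h P n ->
  exists u : C -> C, [/\ hol_at u 0, u 0 != 0, plim b a0 0 &
   exists2 d : R, 0 < d & forall a, a != a0 -> normc (a - a0) < d -> b a != 0 /\
     (h (Qp a) = b a ^ n * u (b a) /\ h (Qm a) = (- b a) ^ n * u (- b a))].
Proof.
move=> cP cQ oP; have [u [hu u0 [d1 d10 H1]]] := has_order_near cP oP.
exists u; have F0 := chart_curve hN cP; rewrite /= expr0n /= in F0.
have bE a : a != a0 -> b a ^+ 2 = (curve_poly P).[a].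
  by move=> /cQ[c1 _]; exact: (chart_curve hN c1).
have pb : plim b a0 0.
  move=> eps eps0; have ee0 : 0 < eps * eps by rewrite mulr_gt0.
  have /cvg_normcP/(_ _ ee0)[d d0 Hd] := hol_at_continuous (hol_at_horner (curve_poly P) a0).
  exists d => // a aa0 /Hd Hda.
  have : normc ((curve_poly P).[a] - (curve_poly P).[a0]) < eps * eps by exact: Hda.
  rewrite -F0 !subr0 -(bE a aa0) expr2 Normc.normcM.
  by rewrite -!expr2 ltr_sqr ?nnegrE ?normc_ge0 // ltW.
split=> //.
have dF : (curve_poly P)^`().[a0] != 0 by exact: (chart_smooth he hN cP).
have [k [d2 [k0 d20 H2]]] := horner_expanding (esym F0) dF.
have [d3 d30 H3] := pb _ d10.
exists (Num.min d1 (Num.min d2 d3)); first by rewrite !lt_min d10 d20.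
move=> a aa0; rewrite !lt_min => /and3P[ad1 ad2 ad3]; have [c1 c2] := cQ a aa0.
have b1 := H3 _ aa0 ad3; rewrite subr0 in b1.
have b2 : normc (- b a) < d1 by rewrite (normcN (b a)).
split.
  (* Near the simple zero a0 the polynomial F is expanding, so b(a) = 0 would force a = a0. *)
  apply/eqP => ba0; have aa : normc (a0 - a0) < d2 by rewrite subrr Normc.normc0.
  have := H2 _ _ ad2 aa; rewrite -(bE a aa0) ba0 -F0 expr0n subrr Normc.normc0.
  by rewrite pmulr_rle0 // leNgt normc_gt0 subr_eq0 aa0.
have := H1 _ _ _ c1 aa0 ad1; have := H1 _ _ _ c2 aa0 ad1.
by rewrite /= eqxx !subr0 => /(_ b2) -> /(_ b1) ->.
Qed.

End Pair.

Definition yroot x := sqrtc (affine_rhs e x).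

Lemma yroot_sqr x : (yroot x) ^+ 2 == affine_rhs e x.
Proof. by rewrite sqr_sqrtc. Qed.

Lemma yrootN_sqr x : (- yroot x) ^+ 2 == affine_rhs e x.
Proof. by rewrite sqrrN sqr_sqrtc. Qed.

Definition lift_plus x : X := inl (Sub (x, yroot x) (yroot_sqr x)).
Definition lift_minus x : X := inl (Sub (x, - yroot x) (yrootN_sqr x)).

(* [sig] is a symmetric function of the values of h at two conjugate points,
   and [Lam P l] is what one retains of its limit l at a branch point P. *)
Section Constant.
Variables (h : X -> C) (n : X -> int) (sig : C -> C -> C) (Lam : X -> C -> Prop).
Hypothesis hn : forall P, has_order h P (n P).
Hypothesis nb : forall P, ~ branch_set g e P -> n P = 0.
Hypothesis sigC : forall a b, sig a b = sig b a.
Hypothesis sig_derivable : forall (u v : C -> C) z, derivable u z 1 -> derivable v z 1 ->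
  u z != 0 -> v z != 0 -> derivable (fun w => sig (u w) (v w)) z 1.
Hypothesis sig_branch : forall P, branch_set g e P -> forall u : C -> C,
  hol_at u 0 -> u 0 != 0 -> exists2 l, Lam P l &
  plim (fun t => sig (t ^ n P * u t) ((- t) ^ n P * u (- t))) 0 l.

Let f x := sig (h (lift_plus x)) (h (lift_minus x)).

Lemma sig_pair_generic (Qp Qm : C -> X) (b : C -> C) (a0 b0 : C) P P' :
  chart P P = Some (a0, b0) -> chart P' P' = Some (a0, - b0) -> b0 != 0 ->
  (forall a, a != a0 -> [/\ chart P (Qp a) = Some (a, b a), chart P (Qm a) = Some (a, - b a),
     chart P' (Qp a) = Some (a, b a) & chart P' (Qm a) = Some (a, - b a)]) ->
  ~ branch_set g e P -> ~ branch_set g e P' ->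
  exists v : C -> C, exists2 d : R, 0 < d & forall w, normc (w - a0) < d ->
    derivable v w 1 /\ (w != a0 -> sig (h (Qp w)) (h (Qm w)) = v w).
Proof.
move=> cP cP' b00 cQ nP nP'.
have oP := hn P; have oP' := hn P'; rewrite nb // in oP; rewrite nb // in oP'.
have [u1 [u2 [hu1 hu2 u10 u20 [d d0 H]]]] := pair_generic cP cP' b00 cQ oP oP'.
have /nbhs_normcP[d1 d10 H1] := hu1; have /nbhs_normcP[d2 d20 H2] := hu2.
have /nbhs_normcP[d3 d30 H3] := near_neq0 (hol_at_continuous hu1) u10.
have /nbhs_normcP[d4 d40 H4] := near_neq0 (hol_at_continuous hu2) u20.
exists (fun w => sig (u1 (w - a0)) (u2 (w - a0))).
exists (Num.min d (Num.min d1 (Num.min d2 (Num.min d3 d4)))).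
  by rewrite !lt_min d0 d10 d20 d30.
move=> w; rewrite !lt_min => /and5P[wd w1 w2 w3 w4].
have E (k : R) : normc (w - a0) < k -> normc (w - a0 - 0) < k by rewrite subr0.
have dsh : derivable (fun w : C => w - a0) w 1.
  exact: (hol_at_derivable (hol_atB (hol_at_id w) (hol_at_cst a0 w))).
split.
  apply: (@sig_derivable (fun w => u1 (w - a0)) (fun w => u2 (w - a0))).
  - exact: (@derivable_comp1 _ u1 (fun w => w - a0) w dsh (H1 _ (E _ w1))).
  - exact: (@derivable_comp1 _ u2 (fun w => w - a0) w dsh (H2 _ (E _ w2))).
  - exact: H3 _ (E _ w3).
  - exact: H4 _ (E _ w4).
by move=> wa; case: (H w wa wd) => -[-> ->]; rewrite // sigC.
Qed.

Lemma plim_pair_branch (Qp Qm : C -> X) (b : C -> C) (a0 : C) P :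
  chart P P = Some (a0, 0) -> branch_set g e P ->
  (forall a, a != a0 -> chart P (Qp a) = Some (a, b a) /\ chart P (Qm a) = Some (a, - b a)) ->
  exists2 l, Lam P l & plim (fun w => sig (h (Qp w)) (h (Qm w))) a0 l.
Proof.
move=> cP bP cQ; have [u [hu u0 pb [d d0 H]]] := pair_branch cP cQ (hn P).
have [l Ll pl] := sig_branch bP hu u0; exists l => //.
pose k t := sig (t ^ n P * u t) ((- t) ^ n P * u (- t)).
have bn w : w != a0 -> normc (w - a0) < d -> b w != 0 by move=> wa /(H w wa)[].
apply: (eq_plim d0 _ (plim_comp d0 pb pl bn)).
by move=> w wa /(H w wa)[_ [-> ->]].
Qed.

Lemma plim_affine c : exists l, [/\ plim f c l,
    forall i, c = e i -> Lam (branch_point g e i) l &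
    c \notin codom e -> exists v : C -> C, exists2 d : R, 0 < d &
      forall w, normc (w - c) < d -> derivable v w 1 /\ (w != c -> f w = v w)].
Proof.
have [cin|nc] := boolP (c \in codom e).
  have /codomP[i ci] := cin.
  have [|||l Ll pl] := @plim_pair_branch lift_plus lift_minus yroot c (branch_point g e i).
  - by rewrite ci.
  - by exists i.
  - by [].
  exists l; split; first exact: pl.
    by move=> j cj; rewrite -(he (etrans (esym ci) cj)).
  by [].
have y0 : yroot c != 0.
  apply: contra nc => /eqP y0; apply/codomP; apply: affine_rhs_eq0.
  by have := yroot_sqr c; rewrite y0 expr0n => /eqP.
have [||||||v [d d0 H]] := @sig_pair_generic lift_plus lift_minus yroot c (yroot c)
  (lift_plus c) (lift_minus c); rewrite //.
- by move=> [i /= [] _ yc]; rewrite yc eqxx in y0.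
- by move=> [i /= [] _ /eqP]; rewrite oppr_eq0 (negPf y0).
exists (v c); split.
- apply: (eq_plim d0 (f := v)); first by move=> w wc /H[_ E]; rewrite /f E.
  apply: continuous_plim; apply: derivable_continuous.
  by apply: (H c _).1; rewrite subrr Normc.normc0.
- by move=> i ci; case/negP: nc; rewrite ci; exact: codom_f.
- by move=> _; exists v, d.
Qed.

(** In the variable a = 1/x the fibre over infinity is treated like a finite one: for even N it
    consists of the unramified points v = 1 and v = -1, for odd N of the branch point v = 0. *)
Lemma plim_infinity : exists2 l, plim (fun a => f a^-1) 0 l &
  forall v : infinite_point g e, branch_set g e (inr v) -> Lam (inr v : X) l.
Proof.
pose b a := yroot a^-1 / a^-1 ^+ g.+1.
have cQ (v : infinite_point g e) a : a != 0 ->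
    chart (inr v : X) (lift_plus a^-1) = Some (a, b a) /\
    chart (inr v : X) (lift_minus a^-1) = Some (a, - b a).
  by move=> a0; rewrite /= invr_eq0 (negPf a0) invrK mulNr.
have [NE|/(N_odd hN) NO] := eqVneq N (2 * g + 2)%N.
  have r1 : infinity_rhs g e 0 = 1.
    by rewrite -horner_infinity_poly /infinity_poly {1}NE subnn expr0 mul1r infinity_cofactor0.
  have h1 : (1 : C) ^+ 2 == infinity_rhs g e 0 by rewrite r1 expr1n.
  have h2 : (- 1 : C) ^+ 2 == infinity_rhs g e 0 by rewrite r1 sqrrN expr1n.
  have nB v : ~ branch_set g e (inr v) by move=> /=; rewrite NE; lia.
  have [||||||w [d d0 H]] := @sig_pair_generic (fun a => lift_plus a^-1)
    (fun a => lift_minus a^-1) b 0 1 (inr (Sub 1 h1)) (inr (Sub (-1) h2)).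
  - by [].
  - by [].
  - exact: oner_neq0.
  - by move=> a a0; split; have [] := cQ (Sub 1 h1) a a0.
  - exact: nB.
  - exact: nB.
  exists (w 0); last by move=> v /nB.
  apply: (eq_plim d0 (f := w)); first by move=> a a0 /H[_ E]; rewrite /f E.
  apply: continuous_plim; apply: derivable_continuous.
  by apply: (H 0 _).1; rewrite subrr Normc.normc0.
have r0 : infinity_rhs g e 0 = 0.
  rewrite -horner_infinity_poly /infinity_poly (_ : (2 * g + 2 - N = 1)%N); last by lia.
  by rewrite expr1 hornerM hornerX mul0r.
have h0 : (0 : C) ^+ 2 == infinity_rhs g e 0 by rewrite r0 expr0n.
have [|||l Ll pl] := @plim_pair_branch (fun a => lift_plus a^-1) (fun a => lift_minus a^-1)
  b 0 (inr (Sub 0 h0)).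
- by [].
- exact: NO.
- by move=> a a0; exact: cQ.
exists l => // v _; rewrite (_ : v = Sub 0 h0) //; apply: val_inj => /=.
by apply/eqP; rewrite -sqrf_eq0 (eqP (valP v)) r0.
Qed.

(** All limits of [f], finite or at infinity, are the same [L]; this is what links the orders of [h]
    at different branch points. *)
Lemma pair_const : exists L, forall P, branch_set g e P -> Lam P L.
Proof.
have [lc Hlc] := choice plim_affine; have [L pL HL] := plim_infinity.
have lcL : forall c, lc c = L.
  apply: (@plim_sphere_const R f lc L (codom e)).
  - by move=> c; have [] := Hlc c.
  - by move=> c nc; have [_ _ /(_ nc)] := Hlc c.
  - move=> eps eps0; have [d d0 Hd] := pL _ eps0; exists d^-1 => z zd.
    have z0 : 0 < normc z by apply: lt_trans zd; rewrite invr_gt0.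
    have zn : z^-1 != 0 by rewrite invr_eq0 -normc_gt0.
    have := Hd _ zn; rewrite subr0 invrK Normc.normcV => H; apply/ltW/H.
    by rewrite -[d]invrK ltf_pV2 ?posrE ?invr_gt0.
exists L => -[q|v] bP; last exact: HL.
have [i qi] := bP; have [_ /(_ i erefl) H _] := Hlc (e i).
rewrite lcL in H; rewrite (_ : inl q = branch_point g e i) //.
by congr inl; exact: val_inj.
Qed.

End Constant.

End Conjugation.

(** * The class group of the branch points *)

Section ClassGroup.
Context {R : realType} (g N : nat) (e : 'I_N -> R[i]).
Hypothesis he : injective e.
Hypothesis hN : N = (2 * g + 2)%N \/ N = (2 * g + 1)%N.
Local Notation C := R[i].
Local Notation X := (hyperelliptic g e).
Implicit Types (P Q : X) (h : X -> C) (f : X -> int).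

(** Order functions in place of formal sums: equalities between divisors become pointwise identities
    of integers, and [infinity_div] needs no presentation by points. *)
Definition principal f := exists h, forall P, has_order h P (f P).

Lemma eq_principal f f' : f =1 f' -> principal f -> principal f'.
Proof. by move=> ff [h H]; exists h => P; rewrite -ff. Qed.

Lemma principalD f f' : principal f -> principal f' -> principal (fun P => f P + f' P).
Proof.
move=> [h H] [h' H']; exists (fun Q => h Q * h' Q) => P.
have [phi [al [be [om lp]]]] := local_paramP he hN P.
apply/(has_orderE _ _ lp).
exact: laurent_orderM ((has_orderE _ _ lp).1 (H P)) ((has_orderE _ _ lp).1 (H' P)).
Qed.

Lemma principalN f : principal f -> principal (fun P => - f P).
Proof.
move=> [h H]; exists (fun Q => (h Q)^-1) => P.
have [phi [al [be [om lp]]]] := local_paramP he hN P.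
apply/(has_orderE _ _ lp).
exact: laurent_orderV ((has_orderE _ _ lp).1 (H P)).
Qed.

Lemma principalB f f' : principal f -> principal f' -> principal (fun P => f P - f' P).
Proof. by move=> pf /principalN; exact: principalD. Qed.

Lemma principal0 : principal (fun=> 0).
Proof.
exists (fun=> 1) => P; have [phi [al [be [om lp]]]] := local_paramP he hN P.
apply/(has_orderE _ _ lp); apply: laurent_order_unit; last exact: oner_neq0.
exact: hol_at_cst.
Qed.

Lemma principalMz (k : int) f : principal f -> principal (fun P => k * f P).
Proof.
move=> pf; have Hn (m : nat) : principal (fun P => m%:Z * f P).
  elim: m => [|m IH]; first by apply: eq_principal principal0 => P; rewrite mul0r.
  by apply: eq_principal (principalD pf IH) => P; rewrite -addn1 PoszD; ring.
case: k => m; first exact: Hn.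
by apply: eq_principal (principalN (Hn m.+1)) => P; rewrite NegzE mulNr.
Qed.

Lemma principal_sum (I : Type) (s : seq I) (F : I -> X -> int) :
  (forall i, principal (F i)) -> principal (fun P => \sum_(i <- s) F i P).
Proof.
move=> H; elim: s => [|i s IH].
  by apply: eq_principal principal0 => P; rewrite big_nil.
by apply: eq_principal (principalD (H i) IH) => P; rewrite big_cons.
Qed.

Variable p : 'I_(2 * g + 2) -> X.
Hypothesis hp : set_bij [set: 'I_(2 * g + 2)] (branch_set g e) p.

Lemma branch_inj : injective p.
Proof. by move=> i j; case: hp => _ pinj _; apply: pinj; rewrite inE. Qed.

Lemma branch_mem i : branch_set g e (p i).
Proof. by case: hp => pb _ _; apply: pb. Qed.

Lemma branch_surj P : branch_set g e P -> exists i, p i = P.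
Proof. by case: hp => _ _ /(_ P) ps /ps[i _ <-]; exists i. Qed.

Notation ind P i := ((P == p i)%:Z).

Lemma sum_ind (a : 'I_(2 * g + 2) -> int) i : \sum_j a j * ind (p i) j = a i.
Proof.
rewrite (bigD1 i) //= eqxx mulr1 big1 ?addr0 // => j ji.
by rewrite (inj_eq branch_inj) eq_sym (negPf ji) mulr0.
Qed.

Lemma sum_ind_branch P : \sum_i ind P i = (P \in branch_set g e)%:Z.
Proof.
have [/set_mem/branch_surj[i <-]|nP] := boolP (P \in branch_set g e).
  by rewrite -[RHS](@sum_ind (fun=> 1) i); apply: eq_bigr => j _; rewrite mul1r.
rewrite big1 // => i _; case: eqP => // E; case/negP: nP; rewrite E.
by apply/mem_set; exact: branch_mem.
Qed.

Lemma principal_branch i : principal (fun P => 2 * ind P i - infinity_div P).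
Proof.
have := branch_mem i; case: (p i) => [q|v] /=.
  move=> [j qj]; have -> : (inl q : X) = branch_point g e j by congr inl; exact: val_inj.
  exists (fun Q => xcoord Q - e j) => P.
  by rewrite mulr_natl; exact: has_order_x he hN j P.
(* Here p_i is the only point over infinity and [ramif] is 2, so 2 p_i equals the polar divisor of x
   exactly. *)
move=> NE; apply: eq_principal principal0 => P.
rewrite /infinity_div /ramif (_ : (N == 2 * g + 2)%N = false); last by apply/eqP; lia.
case: P => [//|w]; rewrite (_ : w = v) ?eqxx ?mulr1 ?subrr //.
have r0 : infinity_rhs g e 0 = 0.
  rewrite -horner_infinity_poly /infinity_poly (_ : (2 * g + 2 - N = 1)%N); last by lia.
  by rewrite expr1 hornerM hornerX mul0r.
have z0 (x : infinite_point g e) : val x = 0.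
  by apply/eqP; rewrite -sqrf_eq0 (eqP (valP x)) r0.
by apply: val_inj; rewrite !z0.
Qed.

Lemma principal_branch_sum (c : 'I_(2 * g + 2) -> int) :
  principal (fun P => \sum_i c i * (2 * ind P i - infinity_div P)).
Proof. by apply: principal_sum => i; exact: principalMz (principal_branch i). Qed.

Lemma principal_all : principal (fun P => \sum_i ind P i - g.+1%:Z * infinity_div P).
Proof.
exists (fun Q => ycoord Q) => P; rewrite sum_ind_branch [_ * infinity_div _]mulrC.
exact: has_order_y.
Qed.

Lemma canonical_principal (E : divisor g e) : canonical_divisor E ->
  principal (fun P => coeff P E - (g%:Z - 1) * infinity_div P).
Proof.
move=> [h H]; exists (fun Q => h Q * ycoord Q) => P.
rewrite [_ * infinity_div _]mulrC; exact: has_form_order_y.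
Qed.

Lemma principal_degree0_ge0 i (m : nat) : principal (fun P => m%:Z * ind P i) -> m = 0%N.
Proof.
move=> [h H].
(* Near a branch point where [h] has order k >= 0 the product of the two values is t^k u(t) (-t)^k
   u(-t); only the vanishing of its limit is recorded. *)
pose Lam P (l : C) := (m%:Z * ind P i = 0 -> l != 0) /\ (0 < m%:Z * ind P i -> l = 0).
have [P nb|u v z du dv _ _|P bP u hu u0|L HL] :=
    @pair_const _ _ _ _ he hN h _ (fun a b => a * b) Lam H _ (fun a b => mulrC a b).
- rewrite (_ : (P == p i) = false) ?mulr0 //; apply/eqP => E; apply: nb; rewrite E.
  exact: branch_mem.
- exact: (@derivableM _ _ u v z 1 du dv).
- have [k kE] : exists k : nat, m%:Z * ind P i = k by exists (m * (P == p i))%N.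
  exists ((0 ^+ k * u 0) * ((- 0) ^+ k * u (- 0))).
    rewrite /Lam kE oppr0; split=> [[->]|]; first by rewrite expr0 !mul1r mulf_neq0.
    by rewrite ltz_nat lt0n => k0; rewrite expr0n (negPf k0) !mul0r.
  rewrite kE; apply: continuous_plim; apply: hol_at_continuous.
  have hN0 : hol_at (fun t : C => - t) 0 := hol_atN (hol_at_id 0).
  apply: hol_atM; first exact: (hol_atM (hol_atX k (hol_at_id 0)) hu).
  apply: hol_atM; first exact: (hol_atX k hN0).
  exact: (@hol_at_comp _ u _ 0 0 hN0 (oppr0 _) hu).
(* A second branch point exists because 2g + 2 >= 2; there the common limit is nonzero, while m > 0
   makes it zero at p_i. *)
have [j ji] : exists j : 'I_(2 * g + 2), j != i.
  have [->|i0] := eqVneq i (Ordinal (ltn_addl (2 * g) (isT : (0 < 2)%N))).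
    by exists (Ordinal (ltn_addl (2 * g) (isT : (1 < 2)%N))).
  by exists (Ordinal (ltn_addl (2 * g) (isT : (0 < 2)%N))); rewrite eq_sym.
have [Lj _] := HL _ (branch_mem j); have [_ Li] := HL _ (branch_mem i).
apply/eqP; rewrite -leqn0 leqNgt; apply/negP => m0.
move: Lj Li; rewrite eqxx mulr1 (inj_eq branch_inj) (negPf ji) mulr0.
by rewrite ltz_nat m0 => /(_ erefl)/eqP Ln /(_ isT).
Qed.

Lemma principal_degree0 i (c : int) : principal (fun P => c * ind P i) -> c = 0.
Proof.
case: c => m H; first by rewrite (principal_degree0_ge0 H).
suff : m.+1 = 0%N by [].
apply: (@principal_degree0_ge0 i); apply: eq_principal (principalN H) => P.
by rewrite NegzE mulNr opprK.
Qed.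

Lemma expN1z (n : int) : (-1 : C) ^ n = (-1) ^+ odd `|n|%N.
Proof.
case: n => m; first by rewrite -[LHS]signr_odd.
by rewrite NegzE -[LHS]invr_expz -[(-1) ^ m.+1%:Z]signr_odd invr_sign abszN.
Qed.

Lemma principal_parity (a : 'I_(2 * g + 2) -> int) :
  principal (fun P => \sum_j a j * ind P j) -> forall i j, odd `|a i|%N = odd `|a j|%N.
Proof.
move=> [h H]; pose n P := \sum_j a j * ind P j.
pose Lam P (l : C) := l = 2 * (-1) ^ n P.
have [P nb|x y|u v z du dv u0 v0|P bP u hu u0|L HL] :=
    @pair_const _ _ _ _ he hN h n (fun a b => a / b + b / a) Lam H.
- rewrite /n big1 // => j _; rewrite (_ : (P == p j) = false) ?mulr0 //.
  by apply/eqP => E; apply: nb; rewrite E; exact: branch_mem.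
- by rewrite addrC.
- have dVu := @derivableV _ _ u z 1 u0 du; have dVv := @derivableV _ _ v z 1 v0 dv.
  exact: (@derivableD _ _ _ _ _ z 1 (@derivableM _ _ u _ z 1 du dVv) (@derivableM _ _ v _ z 1 dv dVu)).
- exists (2 * (-1) ^ n P) => //.
  have hN0 : hol_at (fun t : C => - t) 0 := hol_atN (hol_at_id 0).
  have huN : hol_at (fun t : C => u (- t)) 0 := @hol_at_comp _ u _ 0 0 hN0 (oppr0 _) hu.
  have uN0 : u (- 0) != 0 by rewrite oppr0.
  (* In the quotients of the two values the powers of t cancel up to the sign (-1)^n, so their sum
     extends holomorphically whatever the order is. *)
  pose k t := (-1) ^ n P * (u t * (u (- t))^-1 + u (- t) * (u t)^-1).
  have hk : hol_at k 0 := hol_atM (hol_at_cst ((-1) ^ n P) 0)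
    (hol_atD (hol_atM hu (hol_atV huN uN0)) (hol_atM huN (hol_atV hu u0))).
  have kE : k 0 = 2 * (-1) ^ n P by rewrite /k oppr0 mulfV // mulrC.
  rewrite -kE; apply: (@eq_plim _ k _ _ _ 1) => //; last first.
    exact: continuous_plim (hol_at_continuous hk).
  move=> t t0 _; rewrite /k -[- t]mulN1r expfzMl mulN1r.
  have tn : t ^ n P != 0 by rewrite expfz_neq0.
  have sgnV : ((-1 : C) ^ n P)^-1 = (-1) ^ n P by rewrite expN1z invr_sign.
  have E1 (s x y w : C) : w != 0 -> s^-1 = s ->
      w * x / (s * w * y) + s * w * y / (w * x) = s * (x / y + y / x).
    move=> w0 sE; rewrite !invfM sE.
    rewrite (_ : w * x * (s * w^-1 * y^-1) = (w * w^-1) * (s * (x / y))); last by ring.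
    rewrite (_ : s * w * y * (w^-1 * x^-1) = (w * w^-1) * (s * (y / x))); last by ring.
    by rewrite mulfV // !mul1r mulrDr.
  by rewrite E1.
move=> i j; have := HL _ (branch_mem i); rewrite (HL _ (branch_mem j)) /Lam /n !sum_ind.
have two0 : (2 : C) != 0 by rewrite pnatr_eq0.
move/(mulfI two0); rewrite !expN1z; case: (odd _); case: (odd _) => //=.
  by rewrite expr1 expr0 => /eqP; rewrite eqNr oner_eq0.
by rewrite expr1 expr0 => /esym/eqP; rewrite eqNr oner_eq0.
Qed.

Definition class_div (k : int) (S : {set 'I_(2 * g + 2)}) P : int :=
  k * infinity_div P + \sum_(i in S) ind P i.

Lemma class_divE k S P :
  class_div k S P = k * infinity_div P + \sum_i (i \in S)%:Z * ind P i.
Proof.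
rewrite /class_div big_mkcond; congr (_ + _); apply: eq_bigr => i _.
by case: (i \in S); rewrite ?mul1r ?mul0r.
Qed.

Lemma card_sum_mem (S : {set 'I_(2 * g + 2)}) : #|S|%:Z = \sum_i (i \in S)%:Z.
Proof.
rewrite -sum1_card big_mkcond (big_morph Posz PoszD (erefl _)).
by apply: eq_bigr => i _; case: (i \in S).
Qed.

(** The term (k - k') D is moved onto p_0 as 2 (k - k') p_0, which changes no parity. The
    coefficients are then odd exactly on the symmetric difference of S and S', which must be empty
    or everything. *)
Lemma class_div_unique k k' S S' :
  principal (fun P => class_div k S P - class_div k' S' P) -> S' = S \/ S' = ~: S.
Proof.
pose i0 : 'I_(2 * g + 2) := Ordinal (ltn_addl (2 * g) (isT : (0 < 2)%N)).
move=> H.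
pose a i : int := (i \in S)%:Z - (i \in S')%:Z + 2 * ((k - k') * (i == i0)%:Z).
have pa : principal (fun P => \sum_i a i * ind P i).
  apply: eq_principal (principalD H (principalMz (k - k') (principal_branch i0))) => P.
  have -> : \sum_i a i * ind P i = \sum_i (i \in S)%:Z * ind P i
      - \sum_i (i \in S')%:Z * ind P i + (k - k') * (2 * ind P i0).
    rewrite -sumrB (_ : (k - k') * _ = \sum_i 2 * ((k - k') * (i == i0)%:Z) * ind P i).
      by rewrite -big_split; apply: eq_bigr => i _ /=; rewrite /a; ring.
    rewrite (bigD1 i0) // eqxx big1 ?addr0 /=; first by ring.
    by move=> i ii0; rewrite (negPf ii0) !mulr0 mul0r.
  by rewrite !class_divE; ring.
have par i : odd `|a i|%N = (i \in S) (+) (i \in S').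
  have oddE (x y : int) : odd `|(x + 2 * y)%R|%N = odd `|x|%N by lia.
  rewrite oddE.
  by case: (i \in S); case: (i \in S').
have cst i : (i \in S) (+) (i \in S') = (i0 \in S) (+) (i0 \in S').
  by rewrite -!par; exact: principal_parity.
case: ((i0 \in S) (+) (i0 \in S')) cst => cst; [right|left]; apply/setP => i; have := cst i.
  by rewrite inE; case: (i \in S); case: (i \in S').
by case: (i \in S); case: (i \in S').
Qed.

(** The sum over S minus the sum over its complement is twice the sum over S minus the sum of all
    p_i, hence equivalent to (#|S| - (g + 1)) D. *)
Lemma class_div_setC k S : principal (fun P => class_div k S P -
  class_div (k + #|S|%:Z - g.+1%:Z) (~: S) P).
Proof.
apply: eq_principal (principalB (principal_branch_sum (fun i => (i \in S)%:Z)) principal_all) => P.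
rewrite !class_divE.
have -> : \sum_i (i \in S)%:Z * (2 * ind P i - infinity_div P) =
    2 * (\sum_i (i \in S)%:Z * ind P i) - #|S|%:Z * infinity_div P.
  by rewrite card_sum_mem mulr_sumr mulr_suml -sumrB; apply: eq_bigr => i _; ring.
have -> : \sum_i ind P i = \sum_i (i \in S)%:Z * ind P i + \sum_i (i \in ~: S)%:Z * ind P i.
  rewrite -big_split; apply: eq_bigr => i _; rewrite inE /=.
  by case: (i \in S); rewrite /= ?mul1r ?mul0r ?addr0 ?add0r.
ring.
Qed.

Lemma class_div_reduce (a : 'I_(2 * g + 2) -> int) : exists (k : int) (S : {set 'I_(2 * g + 2)}),
  2 * k + #|S|%:Z = \sum_i a i /\
  principal (fun P => \sum_i a i * ind P i - class_div k S P).
Proof.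
(* Euclidean division of each coefficient by 2: remainders form S, quotients add up to k, and 2k +
   #|S| remains the degree. *)
pose S : {set 'I_(2 * g + 2)} := [set i | (a i %% 2)%Z == 1]%SET; pose c i := (a i %/ 2)%Z.
have aE i : a i = 2 * c i + (i \in S)%:Z by rewrite /S inE /c; lia.
exists (\sum_i c i), S; split.
  by rewrite mulr_sumr card_sum_mem -big_split; apply: eq_bigr => i _; rewrite [RHS]aE.
apply: eq_principal (principal_branch_sum c) => P.
rewrite class_divE mulr_suml -big_split -sumrB; apply: eq_bigr => i _.
by rewrite [a i]aE /=; ring.
Qed.

(** The degree of an m-spin divisor is (g - 1)/n. Trading every 2 p_i, and the canonical class, for
    multiples of 2 p_0 leaves 2 (A - (g - 1)) p_0 principal, so this coefficient is 0. *)
Lemma spin_degree (n : nat) (a : 'I_(2 * g + 2) -> int) :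
  principal (fun P => \sum_i (2 * n)%:Z * a i * ind P i - (g%:Z - 1) * infinity_div P) ->
  n%:Z * \sum_i a i = g%:Z - 1.
Proof.
pose i0 : 'I_(2 * g + 2) := Ordinal (ltn_addl (2 * g) (isT : (0 < 2)%N)).
move=> H; set A := n%:Z * _.
have H1 := principal_branch_sum (fun i => n%:Z * a i).
have H2 := principalMz (A - (g%:Z - 1)) (principal_branch i0).
have H3 : principal (fun P => (2 * (A - (g%:Z - 1))) * ind P i0).
  apply: eq_principal (principalD (principalB H H1) H2) => P.
  have -> : \sum_i n%:Z * a i * (2 * ind P i - infinity_div P) =
     \sum_i (2 * n)%:Z * a i * ind P i - A * infinity_div P.
    rewrite /A mulr_sumr mulr_suml -sumrB; apply: eq_bigr => i _.
    by rewrite PoszM; ring.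
  ring.
by have := principal_degree0 H3; lia.
Qed.

End ClassGroup.

(** * The bounds on k as bounds on the number of points *)

Lemma k_min_diff (g n s : nat) (k : int) : (0 < n)%N ->
  n%:Z * (2 * k + s%:Z) = g%:Z - 1 ->
  k%:~R - k_min g n = (g%:R + 1 - s%:R) / 2 :> rat.
Proof.
move=> n0 /(congr1 (fun z : int => z%:~R : rat)).
rewrite !(rmorphM, rmorphD, rmorphB, rmorph1) /= => H.
have nn0 : n%:R != 0 :> rat by rewrite pnatr_eq0 -lt0n.
rewrite /k_min; have -> : g%:R = n%:R * (2 * k%:~R + s%:R) + 1 :> rat by rewrite -[n%:R]/(n%:~R) H subrK.
by field.
Qed.

Lemma k_max_diff (g n s : nat) (k : int) : (0 < n)%N ->
  n%:Z * (2 * k + s%:Z) = g%:Z - 1 -> k_max g n - k%:~R = s%:R / 2 :> rat.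
Proof.
move=> n0 /(congr1 (fun z : int => z%:~R : rat)).
rewrite !(rmorphM, rmorphD, rmorphB, rmorph1) /= => H.
have nn0 : n%:R != 0 :> rat by rewrite pnatr_eq0 -lt0n.
rewrite /k_max; have -> : g%:R = n%:R * (2 * k%:~R + s%:R) + 1 :> rat by rewrite -[n%:R]/(n%:~R) H subrK.
by field.
Qed.

(** Under the degree equation, [k_min] is the value of k at #|S| = g + 1 and [k_max] its value at
    #|S| = 0. The two bounds on k thus say 0 <= #|S| <= g + 1. *)
Lemma admissibleP (g n : nat) (k : int) (S : {set 'I_(2 * g + 2)}) : (0 < n)%N ->
  admissible n k S <-> n%:Z * (2 * k + #|S|%:Z) = g%:Z - 1 /\ (#|S| <= g.+1)%N.
Proof.
move=> n0; have nn0 : n%:R != 0 :> rat by rewrite pnatr_eq0 -lt0n.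
split=> [[h1 h2 h3]|[E Sg]].
  have E : n%:Z * (2 * k + #|S|%:Z) = g%:Z - 1.
    have E : n%:R * (2 * k%:~R + #|S|%:R) = g%:R - 1 :> rat by rewrite h3; field.
    apply/eqP; rewrite -(eqr_int rat) !(rmorphM, rmorphD, rmorphB, rmorph1) /=.
    exact/eqP.
  split=> //; have := k_min_diff n0 E; rewrite -(ler_nat rat) -[g.+1]addn1 natrD; lra.
have := k_min_diff n0 E; have := k_max_diff n0 E => d2 d1.
have s0 : 0 <= #|S|%:R :> rat by rewrite ler0n.
have sg : #|S|%:R <= g%:R + 1 :> rat by rewrite -(ler_nat rat) -[g.+1]addn1 natrD in Sg.
split; [lra | lra |].
have : #|S|%:R = 2 * (k_max g n - k%:~R) by rewrite d2; field.
by move=> ->; rewrite /k_max; field.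
Qed.

Theorem theorem27 (R : realType) (g N : nat) (e : 'I_N -> R[i])
    (he : injective e)
    (hN : N = (2 * g + 2)%N \/ N = (2 * g + 1)%N)
    (p : 'I_(2 * g + 2) -> hyperelliptic g e)
    (hp : set_bij [set: 'I_(2 * g + 2)] (branch_set g e) p)
    (D : divisor g e) (i0 : 'I_(2 * g + 2))
    (hD : linear_equiv D (<< p i0 >> *+ 2))
    (m n : nat) (hm2 : (2 <= m)%N) (hm : m = (2 * n)%N)
    (hn : (n%:Z %| g%:Z - 1)%Z) :
  (forall theta : divisor g e,
     is_spin_divisor m theta -> supported_on_branch_set theta ->
     [/\ exists (k : int) (S : {set 'I_(2 * g + 2)}),
           admissible n k S /\ linear_equiv theta (branch_divisor p D k S),
         forall (k k' : int) (S S' : {set 'I_(2 * g + 2)}),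
           admissible n k S -> admissible n k' S' ->
           linear_equiv theta (branch_divisor p D k S) ->
           linear_equiv theta (branch_divisor p D k' S') ->
           k_min g n < k%:~R -> k' = k /\ S' = S
       & forall (k k' : int) (S S' : {set 'I_(2 * g + 2)}),
           admissible n k S -> admissible n k' S' ->
           linear_equiv theta (branch_divisor p D k S) ->
           linear_equiv theta (branch_divisor p D k' S') ->
           k%:~R = k_min g n -> k' = k /\ (S' = S \/ S' = (~: S)%SET)]) /\
  (forall (k : int) (S : {set 'I_(2 * g + 2)}),
     k%:~R = k_min g n -> #|S| = g.+1 ->
     linear_equiv (branch_divisor p D k S) (branch_divisor p D k (~: S)%SET)).
Proof.
have n0 : (0 < n)%N by lia.
have cind P i : coeff P << p i >> = (P == p i)%:Z by rewrite coeffU mul1r eq_sym; case: eqP.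
have leE (E E' : divisor g e) : linear_equiv E E' <->
    principal (fun P => coeff P E - coeff P E').
  rewrite -[linear_equiv E E']/(principal (fun P => coeff P (E - E'))).
  by split; apply: eq_principal => P; rewrite coeffB.
(* [D] is given only up to equivalence, as 2 p_(i0), while the computations use the polar divisor of
   x; the discrepancy is principal and gets absorbed in [bdE]. *)
have D_inf : principal (fun P => coeff P D - infinity_div P).
  apply: eq_principal (principalD he hN ((leE _ _).1 hD) (principal_branch he hN hp i0)) => P.
  by rewrite coeffMn cind; ring.
have cbd k S P : coeff P (branch_divisor p D k S) =
    class_div p k S P + k * (coeff P D - infinity_div P).
  rewrite /branch_divisor /class_div coeffD raddf_sum raddfMz /=.
  rewrite (eq_bigr (fun i => (P == p i)%:Z)) => [|i _]; last exact: cind.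
  by rewrite -mulrzl; ring.
have bdE (theta : divisor g e) k S : linear_equiv theta (branch_divisor p D k S) <->
    principal (fun P => coeff P theta - class_div p k S P).
  have pk := principalMz he hN k D_inf.
  split=> H.
    by apply: eq_principal (principalD he hN ((leE _ _).1 H) pk) => P; rewrite cbd; ring.
  apply/leE; apply: eq_principal (principalB he hN H pk) => P; rewrite cbd; ring.
split; last first.
  move=> k S kE cS; apply/bdE; have pk := principalMz he hN k D_inf.
  apply: eq_principal (principalD he hN (class_div_setC he hN hp k S) pk) => P.
  by rewrite cbd cS addrK; ring.
move=> theta [E cE spin] [T thT Tb].
have uniq k k' S S' : admissible n k S -> admissible n k' S' ->
    linear_equiv theta (branch_divisor p D k S) ->
    linear_equiv theta (branch_divisor p D k' S') ->
    [/\ n%:Z * (2 * k + #|S|%:Z) = g%:Z - 1, (#|S| <= g.+1)%N, (#|S'| <= g.+1)%N,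
       2 * k + #|S|%:Z = 2 * k' + #|S'|%:Z & S' = S \/ S' = ~: S].
  move=> /(admissibleP _ _ n0)[e1 s1] /(admissibleP _ _ n0)[e2 s2] /bdE q1 /bdE q2.
  split=> //; first by apply: (mulfI (_ : n%:Z != 0)); [lia | rewrite e1 e2].
  apply: (class_div_unique he hN hp (k := k) (k' := k')).
  by apply: eq_principal (principalB he hN q2 q1) => P; ring.
split.
- pose a i := coeff (p i) T.
  have TE P : coeff P T = \sum_i a i * (P == p i)%:Z.
    have [nT|nT] := eqVneq (coeff P T) 0; last first.
      by have [i <-] := branch_surj hp (Tb _ nT); rewrite (sum_ind hp).
    rewrite big1 // => i _; case: eqP => [Pi|]; last by rewrite mulr0.
    by rewrite /a -Pi nT mul0r.
  have thA := (leE _ _).1 thT.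
  have nA : n%:Z * \sum_i a i = g%:Z - 1.
    apply: (spin_degree he hN hp).
    have canE := canonical_principal he hN cE.
    apply: eq_principal (principalB he hN (principalD he hN ((leE _ _).1 spin) canE)
      (principalMz he hN m%:Z thA)) => P.
    have -> : \sum_i (2 * n)%:Z * a i * (P == p i)%:Z = m%:Z * coeff P T.
      by rewrite TE hm mulr_sumr; apply: eq_bigr => i _; rewrite mulrA.
    by rewrite coeffMn -mulr_natl natz; ring.
  have [k [S [kS pS]]] := class_div_reduce he hN hp a.
  have thS : principal (fun P => coeff P theta - class_div p k S P).
    by apply: eq_principal (principalD he hN thA pS) => P; rewrite TE; ring.
  have [Sg|Sg] := leqP #|S| g.+1.
    exists k, S; split; last exact/bdE.
    by apply/(admissibleP _ _ n0); rewrite kS.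
  (* Too many points: the complement has at most g of them, and the shift of k preserves the
     degree. *)
  have cC : (#|S| + #|~: S| = 2 * g + 2)%N by rewrite cardsC card_ord.
  exists (k + #|S|%:Z - g.+1%:Z), (~: S)%SET; split.
    apply/(admissibleP _ _ n0); split; last by lia.
    rewrite -nA -kS; congr (_ * _); lia.
  apply/bdE; apply: eq_principal (principalD he hN thS (class_div_setC he hN hp k S)) => P.
  ring.
- move=> k k' S S' aS aS' l1 l2 kk; have [e1 s1 s2 ee SS] := uniq _ _ _ _ aS aS' l1 l2.
  have d := k_min_diff n0 e1.
  have sg : (#|S| < g.+1)%N by rewrite -(ltr_nat rat) -[g.+1]addn1 natrD; lra.
  have cC : (#|S| + #|~: S| = 2 * g + 2)%N by rewrite cardsC card_ord.
  (* A bound [k_min < k] means #|S| < g + 1, so the complement has more than g + 1 points and is not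
     admissible. *)
  by case: SS => SE; move: ee s2; rewrite SE; [split=> //; lia | lia].
- move=> k k' S S' aS aS' l1 l2 kk; have [e1 s1 s2 ee SS] := uniq _ _ _ _ aS aS' l1 l2.
  have d := k_min_diff n0 e1.
  have sg : #|S| = g.+1.
    by apply/eqP; rewrite -(eqr_nat rat) -[g.+1]addn1 natrD; apply/eqP; lra.
  have cC : (#|S| + #|~: S| = 2 * g + 2)%N by rewrite cardsC card_ord.
  split; last exact: SS.
  (* S and its complement both have g + 1 points, so equality of degrees gives [k' = k] in either
     case. *)
  by case: SS => SE; move: ee; rewrite SE; lia.
Qed.
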